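(* Let $(M,\varphi,\xi,\eta,g)$ be a Kenmotsu manifold of dimension $2n+1$. Suppose $g$ is a $*$-Ricci soliton with a non-zero potential vector field $V$, i.e. $\pounds_V g+2S^*+2\lambda g=0$ for some constant $\lambda\in\mathbb{R}$, and suppose that $V$ is pointwise collinear with the characteristic vector field $\xi$ (that is, $V=a\xi$ for a smooth function $a$ on $M$). Then $M$ is Einstein and $V=\xi$.
   Context: All manifolds, tensors and functions are smooth; $\mathfrak{X}(M)$ denotes the vector fields on $M$; $\pounds$ is the Lie derivative; $\nabla$ is the Levi-Civita connection of $g$. An almost contact metric manifold $(M,\varphi,\xi,\eta,g)$ of dimension $2n+1$ ($n\ge 1$) is a smooth manifold with a $(1,1)$-tensor field $\varphi$, a vector field $\xi$ (the characteristic vector field), a 1-form $\eta$ and a Riemannian metric $g$ such that $\varphi^2=-I+\eta\otimes\xi$, $\eta(\xi)=1$ and $g(\varphi X,\varphi Y)=g(X,Y)-\eta(X)\eta(Y)$ for all $X,Y\in\mathfrak{X}(M)$. It is called Kenmotsu if $(\nabla_X\varphi)Y=g(\varphi X,Y)\xi-\eta(Y)\varphi X$ for all $X,Y\in\mathfrak{X}(M)$. The curvature convention is $R(X,Y)=[\nabla_X,\nabla_Y]-\nabla_{[X,Y]}$; the Ricci tensor is $S(Y,Z)=\mathrm{trace}(X\mapsto R(X,Y)Z)$. The $*$-Ricci tensor is $S^*(X,Y)=\frac12\,\mathrm{trace}\big(Z\mapsto R(X,\varphi Y)\varphi Z\big)$. $M$ is Einstein if $S=cg$ for some constant $c$. 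*)

(* Defs.v *)
From HB Require Import structures.
From mathcomp Require Import all_boot all_order all_algebra.
From mathcomp Require Import all_classical all_reals all_analysis.

Set Implicit Arguments.
Unset Strict Implicit.
Unset Printing Implicit Defensive.

Import Order.TTheory GRing.Theory Num.Theory.
Import numFieldNormedType.Exports.

Local Open Scope classical_set_scope.
Local Open Scope ring_scope.

(* Used with U open and V, W finite-dimensional: f is C^{k+1} on U iff it is
   Frechet differentiable on U and all its directional derivatives are C^k on
   U.  The values of f outside U are irrelevant (Ck_on_ext). *)
Fixpoint Ck_on (R : realType) (V W : normedModType R) (k : nat)
    (U : set V) (f : V -> W) : Prop :=
  if k is k'.+1 then
    (forall x, U x -> differentiable f x) /\
    (forall v : V, Ck_on k' U (fun x => 'D_v f x))
  else forall x, U x -> {for x, continuous f}.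

Definition smooth_on (R : realType) (V W : normedModType R)
    (U : set V) (f : V -> W) : Prop := forall k, Ck_on k U f.

Section SmoothOn.
Context (R : realType) (V : normedModType R).
Implicit Types (U : set V).

Lemma near_eq_differentiable (W : normedModType R) (f g : V -> W) (x : V) :
  (\forall y \near x, f y = g y) -> differentiable f x -> differentiable g x.
Proof.
move=> fg /diff_locallyP[cdf /eqaddoP fE].
have fgx : f x = g x by apply: (nbhs_singleton fg).
have fg0 : \forall h \near (0 : V), f (h + x) = g (h + x).
  move: fg; rewrite (near_shift 0 x) /=; apply: filterS => h /=.
  by rewrite subr0.
have gE : g \o shift x = cst (g x) + 'd f x +o_ (0 : V) id.
  apply/eqaddoP => e e0; near=> h.
  have -> : (g \o shift x - (cst (g x) + 'd f x)) h
          = (f \o shift x - (cst (f x) + 'd f x)) h.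
    by rewrite !fctE /= fgx; congr (_ - _); apply/esym; near: h.
  by near: h; exact: fE.
by apply/diff_locallyP; rewrite (diff_unique cdf gE).
Unshelve. all: by end_near. Qed.

Lemma Ck_on_ext (W : normedModType R) k U (f g : V -> W) :
  open U -> (forall x, U x -> f x = g x) -> Ck_on k U f -> Ck_on k U g.
Proof.
move=> oU; elim: k f g => [|k IH] f g fg.
  move=> /= cf x Ux.
  have nfg : \forall y \near x, f y = g y.
    by apply: filterS (open_nbhs_nbhs (conj oU Ux)) => y; exact: fg.
  rewrite /prop_for /continuous_at -(fg _ Ux).
  exact: cvg_trans (near_eq_cvg nfg) (cf x Ux).
have nfg x : U x -> \forall y \near x, f y = g y.
  by move=> Ux; apply: filterS (open_nbhs_nbhs (conj oU Ux)) => y; exact: fg.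
move=> [df cf]; split=> [x Ux|v].
  exact: near_eq_differentiable (nfg x Ux) (df x Ux).
apply: IH (cf v) => x Ux; exact: near_eq_derive (nfg x Ux).
Qed.

Lemma Ck_on_le (W : normedModType R) k U (f : V -> W) :
  Ck_on k.+1 U f -> Ck_on k U f.
Proof.
elim: k f => [|k IH] f [df cf]; last by split => // v; exact: IH.
by move=> x Ux; exact/differentiable_continuous/df.
Qed.

Lemma Ck_on_cst (W : normedModType R) k U (a : W) : Ck_on k U (cst a : V -> W).
Proof.
elim: k a => [|k IH] a /=; first by move=> x _; exact: cst_continuous.
split=> [x _|v]; first exact: differentiable_cst.
have -> : (fun x => 'D_v (cst a : V -> W) x) = cst 0.
  by apply/funext => x; rewrite derive_cst.
exact: IH.
Qed.

Lemma Ck_onD k U (f g : V -> R) :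
  open U -> Ck_on k U f -> Ck_on k U g -> Ck_on k U (f + g).
Proof.
move=> oU; elim: k f g => [|k IH] f g.
  by move=> /= cf cg x Ux; apply: continuousD; [exact: cf|exact: cg].
move=> [df cf] [dg cg]; split=> [x Ux|v].
  by apply: differentiableD; [exact: df|exact: dg].
apply: Ck_on_ext (IH _ _ (cf v) (cg v)) => // x Ux.
by rewrite deriveD //; apply: diff_derivable; [exact: df|exact: dg].
Qed.

Lemma Ck_onM k U (f g : V -> R) :
  open U -> Ck_on k U f -> Ck_on k U g -> Ck_on k U (f * g).
Proof.
move=> oU; elim: k f g => [|k IH] f g.
  by move=> /= cf cg x Ux; apply: continuousM; [exact: cf|exact: cg].
move=> Cf Cg; have [df cf] := Cf; have [dg cg] := Cg; split=> [x Ux|v].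
  by apply: differentiableM; [exact: df|exact: dg].
apply: (@Ck_on_ext _ _ _
  (f * (fun x => 'D_v g x) + g * (fun x => 'D_v f x))) => //.
  move=> x Ux; rewrite deriveM //; apply: diff_derivable.
    exact: df.
  exact: dg.
apply: Ck_onD => //; apply: IH.
- exact: Ck_on_le Cf.
- exact: cg.
- exact: Ck_on_le Cg.
- exact: cf.
Qed.

End SmoothOn.

Record chart (R : realType) (m : nat) (M : topologicalType) := Chart {
  chart_dom : set M;
  chart_map : M -> 'rV[R]_m;
  chart_inv : 'rV[R]_m -> M;
  chart_dom_open : open chart_dom;
  chart_img_open : open (chart_map @` chart_dom);
  chart_mapK : forall p, chart_dom p -> chart_inv (chart_map p) = p;
  chart_map_continuous :
    forall p, chart_dom p -> {for p, continuous chart_map};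
  chart_inv_continuous :
    forall x, (chart_map @` chart_dom) x -> {for x, continuous chart_inv}
}.

(* The smooth structure is the one generated by the (not necessarily maximal)
   atlas. *)
Record manifold (R : realType) (m : nat) := Manifold {
  carrier :> topologicalType;
  atlas : set (chart R m carrier);
  manifold_hausdorff : hausdorff_space carrier;
  manifold_second_countable : @second_countable carrier;
  atlas_cover : forall p : carrier, exists2 c, atlas c & chart_dom c p;
  atlas_compatible : forall c c', atlas c -> atlas c' ->
    smooth_on (chart_map c @` (chart_dom c `&` chart_dom c'))
      (chart_map c' \o chart_inv c)
}.

Section SmoothFunctions.
Context (R : realType) (m : nat) (M : manifold R m).

Definition smooth (f : M -> R) : Prop :=
  forall c, atlas c ->
    smooth_on (chart_map c @` chart_dom c) (f \o chart_inv c).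

Definition smooth_pred : {pred M -> R} := fun f => `[< smooth f >].

Lemma smooth_cst (r : R) : cst r \in smooth_pred.
Proof. by apply/asboolP => c _ k; exact: Ck_on_cst. Qed.

Lemma smooth_subring : subring_closed smooth_pred.
Proof.
have sM (f g : M -> R) :
    f \in smooth_pred -> g \in smooth_pred -> f * g \in smooth_pred.
  move=> /asboolP sf /asboolP sg; apply/asboolP => c ac k.
  by apply: Ck_onM; [exact: chart_img_open|exact: sf|exact: sg].
split; [exact: (smooth_cst 1)| |exact: sM] => f g sf sg.
have /asboolP sNg : - g \in smooth_pred.
  by rewrite -mulN1r; apply: sM => //; exact: (smooth_cst (- 1)).
move: sf => /asboolP sf; apply/asboolP => c ac k.
by apply: Ck_onD; [exact: chart_img_open|exact: sf|exact: sNg].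
Qed.

HB.instance Definition _ :=
  GRing.isSubringClosed.Build (M -> R) smooth_pred smooth_subring.

Record Cinf := MkCinf { Cinf_fun :> M -> R; _ : Cinf_fun \in smooth_pred }.

HB.instance Definition _ := [isSub for Cinf_fun].
HB.instance Definition _ := [Choice of Cinf by <:].
HB.instance Definition _ :=
  GRing.SubChoice_isSubComPzRing.Build _ _ Cinf smooth_subring.

Definition Cinf_cst (r : R) : Cinf := MkCinf (smooth_cst r).

Definition is_derivation (D : Cinf -> Cinf) : Prop :=
  [/\ forall r f, D (Cinf_cst r * f) = Cinf_cst r * D f,
      forall f g, D (f + g) = D f + D g &
      forall f g, D (f * g) = D f * g + f * D g].

Definition derivation_pred : {pred Cinf -> Cinf^o} :=
  fun D => `[< is_derivation D >].

Lemma derivation_submod : submod_closed derivation_pred.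
Proof.
split.
  have E0 f : (0 : Cinf -> Cinf^o) f = 0 by [].
  apply/asboolP; split=> [r f|f g|f g]; rewrite !E0.
  - by rewrite mulr0.
  - by rewrite addr0.
  - by rewrite mul0r mulr0 addr0.
move=> h D E /asboolP[DZ DD DM] /asboolP[EZ ED EM].
have scE f : (h *: D + E) f = h * D f + E f by [].
apply/asboolP; split=> [r f|f g|f g]; rewrite !scE.
- by rewrite DZ EZ mulrDr mulrCA.
- by rewrite DD ED mulrDr addrACA.
- by rewrite DM EM !mulrDr !mulrDl mulrA addrACA (mulrCA h).
Qed.

HB.instance Definition _ :=
  GRing.isSubmodClosed.Build Cinf (Cinf -> Cinf^o) derivation_pred
    derivation_submod.

(* Vector fields are the R-linear derivations of the algebra of smooth
   functions, with their structure of module over that algebra. *)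
Record vfield := MkVfield {
  vfield_fun :> Cinf -> Cinf^o; _ : vfield_fun \in derivation_pred }.

HB.instance Definition _ := [isSub for vfield_fun].
HB.instance Definition _ := [Choice of vfield by <:].
HB.instance Definition _ := [SubChoice_isSubLmodule of vfield by <:].

Lemma lie_bracket_subproof (X Y : vfield) :
  (fun f => X (Y f) - Y (X f)) \in derivation_pred.
Proof.
have aux (u v w z s t : Cinf) :
    u + v + (w + z) - (s + w + (v + t)) = u - s + (z - t).
  rewrite [w + z]addrC addrACA [v + t]addrC [s + w + _]addrACA [w + v]addrC.
  by rewrite opprD [LHS]addrACA subrr addr0 opprD [LHS]addrACA.
case: X Y => [X /asboolP[XZ XD XM]] [Y /asboolP[YZ YD YM]] /=.
apply/asboolP; split=> [r f|f g|f g].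
- by rewrite YZ XZ XZ YZ mulrBr.
- by rewrite YD XD XD YD opprD addrACA.
- rewrite YM XM XD YD !XM !YM mulrBl mulrBr.
  exact: aux.
Qed.

Definition lie_bracket (X Y : vfield) : vfield :=
  MkVfield (lie_bracket_subproof X Y).

End SmoothFunctions.

Section Geometry.
Context (R : realType) (m : nat) (M : manifold R m).
Local Notation C := (Cinf M).
Local Notation X_M := (vfield M).
Implicit Types (X Y Z V : X_M) (f : C) (p : M).

Definition tangent_eq p X Y : Prop := forall f, X f p = Y f p.

(* Since dim T_p M = m, m linearly independent vectors form a basis. *)
Definition frame_at p (E : 'I_m -> X_M) : Prop :=
  forall a : 'I_m -> R,
    (forall f, \sum_(i < m) a i * E i f p = 0) -> forall i, a i = 0.

Definition matrix_at p (E : 'I_m -> X_M) (T : X_M -> X_M)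
    (A : 'M[R]_m) : Prop :=
  forall j f, T (E j) f p = \sum_(i < m) A i j * E i f p.

(* The trace at p of the endomorphism of T_p M induced by T, meaningful when T
   is linear over the smooth functions. *)
Definition trace (T : X_M -> X_M) p : R :=
  xget 0 [set t | exists E A,
    [/\ frame_at p E, matrix_at p E T A & t = \tr A]].

Record riemannian_metric (g : X_M -> X_M -> C) : Prop := RiemannianMetric {
  metric_sym : forall X Y, g X Y = g Y X;
  metric_linear : forall f X Y Z, g (f *: X + Y) Z = f * g X Z + g Y Z;
  metric_pos : forall p X, ~ tangent_eq p X 0 -> 0 < g X X p
}.

Record levi_civita (g : X_M -> X_M -> C) (nabla : X_M -> X_M -> X_M) : Prop :=
  LeviCivita {
  connection_linear : forall f X Y Z,
    nabla (f *: X + Y) Z = f *: nabla X Z + nabla Y Z;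
  connection_add : forall X Y Z, nabla X (Y + Z) = nabla X Y + nabla X Z;
  connection_leibniz : forall f X Y,
    nabla X (f *: Y) = (X f : C) *: Y + f *: nabla X Y;
  connection_torsion_free : forall X Y,
    nabla X Y - nabla Y X = lie_bracket X Y;
  connection_metric : forall X Y Z,
    X (g Y Z) = g (nabla X Y) Z + g Y (nabla X Z)
}.

Definition lie_derivative_metric V (g : X_M -> X_M -> C) X Y : C :=
  V (g X Y) - g (lie_bracket V X) Y - g X (lie_bracket V Y).

Definition curvature (nabla : X_M -> X_M -> X_M) X Y Z : X_M :=
  nabla X (nabla Y Z) - nabla Y (nabla X Z) - nabla (lie_bracket X Y) Z.

Definition ricci (nabla : X_M -> X_M -> X_M) Y Z : M -> R :=
  trace (fun X => curvature nabla X Y Z).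

Definition einstein (g : X_M -> X_M -> C) (nabla : X_M -> X_M -> X_M) : Prop :=
  exists c : R, forall X Y p, ricci nabla X Y p = c * g X Y p.

End Geometry.

Record almost_contact_metric (R : realType) (m : nat) (M : manifold R m) :=
  AlmostContactMetric {
  acm_phi : {linear vfield M -> vfield M};
  acm_xi : vfield M;
  acm_eta : {linear vfield M -> (Cinf M)^o};
  acm_g : vfield M -> vfield M -> Cinf M;
  acm_riemannian : riemannian_metric acm_g;
  acm_phi2 : forall X,
    acm_phi (acm_phi X) = - X + (acm_eta X : Cinf M) *: acm_xi;
  acm_eta_xi : acm_eta acm_xi = 1;
  acm_compatible : forall X Y,
    acm_g (acm_phi X) (acm_phi Y) = acm_g X Y - acm_eta X * acm_eta Y
}.

Section AlmostContact.
Context (R : realType) (m : nat) (M : manifold R m).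
Context (S : almost_contact_metric M)
  (nabla : vfield M -> vfield M -> vfield M).
Local Notation phi := (acm_phi S).
Local Notation xi := (acm_xi S).
Local Notation eta := (acm_eta S).
Local Notation g := (acm_g S).

Definition kenmotsu : Prop := forall X Y : vfield M,
  nabla X (phi Y) - phi (nabla X Y) =
  g (phi X) Y *: xi - (eta Y : Cinf M) *: phi X.

Definition star_ricci (X Y : vfield M) (p : M) : R :=
  2^-1 * trace (fun Z => curvature nabla X (phi Y) (phi Z)) p.

Definition star_ricci_soliton (V : vfield M) (lam : R) : Prop :=
  forall (X Y : vfield M) (p : M),
    lie_derivative_metric V g X Y p + 2 * star_ricci X Y p
      + 2 * lam * g X Y p = 0.

End AlmostContact.

(* Main.v *)
(* Let [T X Y Z = R(X,Y)Z + g(Y,Z)X - g(X,Z)Y] and [h = g - eta eta].  On a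
   Kenmotsu manifold [T] has all the symmetries of a Kaehler curvature tensor
   transverse to [xi], so that [trace (Z |-> T(X, phi Y) phi Z)], which equals
   [2 (S* + h)], is also twice [P = S + 2n g]; and the second Bianchi identity
   gives [nabla_xi T = - 2 T].  For [V = a xi] the soliton equation evaluated on
   [xi] yields [da = - lam eta], and then [S* + h = (1 - a - lam) h].
   Differentiating this along [xi], a trace commuting with [nabla_xi], gives
   [a = 1 - lam / 2].  So [a] is constant, [lam = - xi a = 0], [a = 1], and
   [P = 0].

   Vector fields being global derivations, traces need local frames of
   [vfield M].  The derivations [G d_i], with [G] a bump function in a chart,
   span near any given point by Hadamard's lemma. *)
Require Import Defs.
From HB Require Import structures.
From mathcomp Require Import all_boot all_order all_algebra.
From mathcomp Require Import all_classical all_reals all_analysis.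
From mathcomp Require Import ring lra.

Set Implicit Arguments.
Unset Strict Implicit.
Unset Printing Implicit Defensive.

Import Order.TTheory GRing.Theory Num.Theory.
Import numFieldNormedType.Exports.

Local Open Scope classical_set_scope.
Local Open Scope ring_scope.

(** * Calculus in finite dimension *)

(** Locally a Kenmotsu manifold is a warped product dt^2 + e^(2t) g_N of a line with a Kaehler
    manifold N, and [T] is the curvature of N; this explains its symmetries and the rate -2 along
    [xi], though the proof derives both tensorially. Since nabla_xi h = 0 while nabla_xi P = - 2 P,
    the relation P = c h with c = 1 - a - lam forces xi c = - 2 c. As xi a = - lam, also xi c = lam,
    and comparing the two determines [a]. Cancelling [h] at a point is where dimension at least 3
    enters. The obstacle is [trace]: it is selected by [xget] and defaults to 0 when no global
    fields form a frame at the point, so nothing is known about it before frames are built, and a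
    choice made point by point cannot be differentiated. The frames built here satisfy their duality
    relations up to a smooth factor [om]. These relations hold on all of M, so they can be
    differentiated; division by [om] happens only at a point where it is non-zero. *)

Section Ck.
Context (R : realType).

(** Continuity and differentiability at a point refer to the ambient space and not to the set, so
    any [A] through the point yields the condition there. *)
Lemma Ck_on_local (V W : normedModType R) k (U : set V) (f : V -> W) :
  (forall x, U x -> exists2 A, A x & Ck_on k A f) -> Ck_on k U f.
Proof.
elim: k f => [|k IH] f loc /=.
  by move=> x Ux; have [A Ax] := loc x Ux; apply.
split=> [x Ux|v]; first by have [A Ax [+ _]] := loc x Ux; apply.
by apply: IH => x Ux; have [A Ax [_ /(_ v)]] := loc x Ux; exists A.
Qed.

Lemma Ck_on_sub (V W : normedModType R) k (U A : set V) (f : V -> W) :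
  A `<=` U -> Ck_on k U f -> Ck_on k A f.
Proof. by move=> AU Cf; apply: Ck_on_local => x /AU Ux; exists U. Qed.

Lemma Ck_on_coord (V : normedModType R) m k (U : set V) (f : V -> 'rV[R]_m) j :
  open U -> Ck_on k U f -> Ck_on k U (fun x => f x 0 j).
Proof.
move=> oU; elim: k f => [|k IH] f /=.
  move=> cf x Ux.
  apply: (@continuous_comp _ _ _ f (fun M : 'rV_m => M 0 j)); first exact: cf.
  exact: coord_continuous.
move=> [df Cf]; split=> [x Ux|v].
  apply: (@differentiable_comp _ _ _ _ f (fun M : 'rV_m => M 0 j)).
    exact: df.
  exact: differentiable_coord.
apply: Ck_on_ext (IH _ (Cf v)) => // x Ux.
by rewrite derive_mx ?mxE //; apply: diff_derivable; exact: df.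
Qed.

Lemma Ck_on_sum (V : normedModType R) k (U : set V) (I : Type) (r : seq I)
    (F : I -> V -> R) :
  open U -> (forall i, Ck_on k U (F i)) -> Ck_on k U (fun x => \sum_(i <- r) F i x).
Proof.
move=> oU CF; elim: r => [|i r IH].
  by apply: Ck_on_ext (Ck_on_cst k U 0) => // x _; rewrite big_nil.
by apply: Ck_on_ext (Ck_onD oU (CF i) IH) => // x _; rewrite big_cons.
Qed.

Lemma derive_row_sum m (f : 'rV[R]_m -> R) x v : differentiable f x ->
  'D_v f x = \sum_(j < m) v 0 j * 'D_(delta_mx 0 j) f x.
Proof.
move=> df; rewrite deriveE // [in LHS](row_sum_delta v) linear_sum.
by apply: eq_bigr => j _; rewrite linearZ deriveE.
Qed.

(** The chain rule is written with the partial derivatives of [f], so that only sums and products of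
    scalar functions occur; the induction hypothesis is applied to these partials, composed with [t]
    taken one order lower. *)
Lemma Ck_on_comp_row (V : normedModType R) m k (U : set V) (A : set 'rV[R]_m)
    (f : 'rV[R]_m -> R) (t : V -> 'rV[R]_m) :
  open U -> (forall x, U x -> A (t x)) ->
  Ck_on k A f -> Ck_on k U t -> Ck_on k U (f \o t).
Proof.
move=> oU tUA; elim: k f => [|k IH] f.
  move=> /= cf ct x Ux; apply: continuous_comp; first exact: ct.
  exact/cf/tUA.
move=> [df Cf] Ct; have [dt CDt] := Ct; split=> [x Ux|v].
  by apply: differentiable_comp; [exact: dt|exact/df/tUA].
apply: (@Ck_on_ext _ _ _ _ _ (fun x => \sum_(j < m)
    ((fun x => ('D_v t x) 0 j) * ('D_(delta_mx 0 j) f \o t)) x)) => //.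
  move=> x Ux; rewrite [in RHS]deriveE; last first.
    by apply: differentiable_comp; [exact: dt|exact/df/tUA].
  rewrite diff_comp; [|exact: dt|exact/df/tUA].
  rewrite /= -(deriveE _ (dt _ Ux)) -(deriveE _ (df _ (tUA _ Ux))).
  by rewrite derive_row_sum //; exact/df/tUA.
apply: Ck_on_sum => // j; apply: Ck_onM => //.
  exact: (Ck_on_coord j oU (CDt v)).
exact: IH (Cf _) (Ck_on_le Ct).
Qed.

Lemma Ck_on_comp_real (V : normedModType R) k (U : set V)
    (f : R -> R) (t : V -> R) :
  open U -> smooth_on setT f -> Ck_on k U t -> Ck_on k U (f \o t).
Proof.
move=> oU; elim: k f => [|k IH] f Sf.
  move=> /= ct x Ux; apply: continuous_comp; first exact: ct.
  exact: (Sf 0%N).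
move=> Ct; have [dt CDt] := Ct; have df := (Sf 1%N).1.
split=> [x Ux|v].
  by apply: differentiable_comp; [exact: dt|exact: df].
apply: (@Ck_on_ext _ _ _ _ _ ((fun x => 'D_v t x) * ('D_1 f \o t))) => //.
  move=> x Ux; rewrite [in RHS]deriveE; last first.
    by apply: differentiable_comp; [exact: dt|exact: df].
  rewrite diff_comp; [|exact: dt|exact: df].
  rewrite /= -(deriveE _ (dt _ Ux)) fctE /= (deriveE (1 : R) (df (t x) Logic.I)).
  rewrite -[in RHS](mulr1 ('D_v t x)) -[X in _ = 'd f _ X]/('D_v t x *: 1).
  by rewrite linearZ.
apply: Ck_onM => //; first exact: CDt.
exact: IH (fun l => (Sf l.+1).2 (1 : R)) (Ck_on_le Ct).
Qed.

Lemma Ck_on_id (V : normedModType R) k (U : set V) : Ck_on k U (id : V -> V).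
Proof.
case: k => [|k] /=; first by move=> x _; exact: id.
split=> [x _|v]; first exact: ex_diff.
rewrite (_ : (fun x => _) = cst v); first exact: Ck_on_cst.
by apply/funext => x; rewrite derive_id.
Qed.

Lemma smooth_on_coord m (U : set 'rV[R]_m) j : open U ->
  smooth_on U (fun y : 'rV[R]_m => y 0 j).
Proof. by move=> oU k; apply: Ck_on_coord => //; exact: Ck_on_id. Qed.

End Ck.

(** * The flat function exp(-1/t) *)

Section Flat.
Context (R : realType).

(** The powers of 1/t make the family stable: the derivative of a member is a combination of two
    others, so one induction proves all of them smooth. *)
Definition flat n (t : R) : R := if 0 < t then t^-1 ^+ n * expR (- t^-1) else 0.

(** With u = 1/t, the bound e^u >= u^(n+1) / (n+1)! gives u^n e^(-u) <= (n+1)! / u. It controls the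
    difference quotient at 0. *)
Lemma flat_le n (t : R) : `|flat n t| <= (n.+1)`!%:R * `|t|.
Proof.
rewrite /flat; case: ifPn => [t0|_]; last by rewrite normr0 mulr_ge0.
have u0 : 0 < t^-1 by rewrite invr_gt0.
rewrite ger0_norm; last by rewrite mulr_ge0 ?exprn_ge0 ?ltW ?expR_gt0.
rewrite gtr0_norm // expRN ler_pdivrMr ?expR_gt0 //.
have := expR_ge1Dxn n (ltW u0).
rewrite -(ler_pM2l t0) -(@ler_pM2l _ (n.+1)`!%:R) ?ltr0n ?fact_gt0 // !mulrA.
move=> E; apply: le_trans _ E; rewrite mulrDr mulr1 -[leLHS]add0r lerD //.
  by rewrite mulr_ge0 // ltW.
have c0 : (n.+1)`!%:R != 0 :> R by rewrite pnatr_eq0 -lt0n fact_gt0.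
rewrite exprSr (_ : _ * t * _ = t^-1 ^+ n * (t^-1 * t)); last by field; rewrite c0 gt_eqF.
by rewrite mulVf ?mulr1 // gt_eqF.
Qed.

Lemma is_derive_flat n (t : R) :
  is_derive t 1 (flat n) (flat n.+2 t - n%:R * flat n.+1 t).
Proof.
have [t0|t0|<-] := ltgtP 0 t.
- apply: (@near_eq_is_derive _ _ _
    ((fun s : R => s^-1) ^+ n * (expR \o (fun s : R => - s^-1)))).
  + near=> s; rewrite /flat ifT; last by near: s; exact: lt_nbhsr.
    by rewrite fctE exprfctE.
  + have dV : is_derive t 1 (fun s : R => s^-1) (- (t ^- 2)).
      have tn0 : t != 0 by rewrite gt_eqF.
      by have := is_deriveV tn0 (is_derive_id t (1 : R)); rewrite scaler1.
    have dE : is_derive t 1 (expR \o (fun s : R => - s^-1))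
        (expR (- t^-1) * - - (t ^- 2)).
      exact: is_derive1_comp.
    apply: is_derive_eq (is_deriveM (is_deriveX n dV) dE) _.
    rewrite /flat t0 /= exprfctE /= /GRing.scale /= !exprS.
    have tn0 : t != 0 by rewrite gt_eqF.
    case: n => [|n] /=; first by rewrite expr0; field.
    by rewrite (exprS _ n); field.
- apply: (@near_eq_is_derive _ _ _ (cst 0)).
    near=> s; rewrite /flat ifF //; apply/negbTE; rewrite -leNgt ltW //; near: s.
    exact: lt_nbhsl.
  have t0F : (0 < t) = false by apply/negbTE; rewrite -leNgt ltW.
  by rewrite /flat t0F mulr0 subr0; exact: is_derive_cst.
- rewrite /flat ltxx mulr0 subr0.
  (* At 0 the difference quotient of [flat n] is bounded by [flat n.+1 h], which tends to 0 by
     [flat_le]. *)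
  have lim0 : h^-1 *: (flat n (h *: 1 + 0) - flat n 0) @[h --> 0^'] --> (0 : R).
    apply/cvgrPdist_le => /= e e0; near=> h.
    rewrite sub0r normrN addr0 /flat ltxx subr0 /GRing.scale /= mulr1.
    apply: (@le_trans _ _ `|flat n.+1 h|).
      rewrite /flat; case: ifP => _; last by rewrite mulr0.
      by rewrite exprS mulrA.
    apply: le_trans (flat_le _ _) _.
    rewrite mulrC -ler_pdivlMr ?ltr0n ?fact_gt0 // ltW //; near: h.
    by apply: dnbhs0_lt; rewrite divr_gt0 // ltr0n fact_gt0.
  by apply: DeriveDef; [apply/cvg_ex; exists 0|exact/cvg_lim].
Unshelve. all: by end_near. Qed.

Lemma smooth_flat n : smooth_on setT (flat n).
Proof.
move=> k; elim: k n => [|k IH] n.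
  move=> x _; apply/differentiable_continuous/derivable1_diffP.
  exact: (@ex_derive _ _ _ _ _ _ _ (is_derive_flat n x)).
have df x : differentiable (flat n) x.
  apply/derivable1_diffP; exact: (@ex_derive _ _ _ _ _ _ _ (is_derive_flat n x)).
split=> [x _|v]; first exact: df.
apply: (@Ck_on_ext _ _ _ _ _ (cst v * (flat n.+2 + cst (- n%:R) * flat n.+1))).
- exact: openT.
- move=> x _; rewrite deriveE // -[X in _ = 'd _ _ X]mulr1.
  rewrite -[X in _ = 'd _ _ X]/(v *: (1 : R)) linearZ -deriveE //.
  by rewrite (@derive_val _ _ _ _ _ _ _ (is_derive_flat n x)) !fctE mulNr.
- apply: Ck_onM; [exact: openT|exact: Ck_on_cst|].
  apply: Ck_onD; [exact: openT|exact: IH|].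
  by apply: Ck_onM; [exact: openT|exact: Ck_on_cst|exact: IH].
Qed.

End Flat.

(** * Integrals along rays and differentiation under the integral sign *)

Section Ray.
Context (R : realType).
Local Notation mu := (@lebesgue_measure R).

(** Tube lemma: compactness of [0, 1] replaces the neighbourhoods of [x] found for each [t] by a
    single one. *)
Lemma unif_continuous_unit (V : normedModType R) (G : V * R -> R) x :
  (forall t : R, 0 <= t <= 1 -> {for (x, t), continuous G}) ->
  forall e : R, 0 < e ->
  \forall y \near x, forall t : R, 0 <= t <= 1 -> `|G (x, t) - G (y, t)| <= e.
Proof.
move=> cG e e0.
have cov : near_covering (`[0, 1] : set R).
  by apply/compact_near_coveringP; exact: segment_compact.
pose P y t := `|G (x, t) - G (y, t)| <= e.
have : \forall y \near x, `[0, 1]%classic `<=` P y.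
  apply: cov.
  move=> t; rewrite /= in_itv /= => t01.
  have e20 : 0 < e / 2 by rewrite divr_gt0.
  have /cvgrPdist_le/(_ _ e20) near_G := cG t t01.
  have [[A B] /= [nA nB] AB] := near_G.
  exists (B, A) => //= -[t' y] /= [Bt' Ay].
  rewrite /P.
  have -> : G (x, t') - G (y, t') = (G (x, t) - G (y, t')) - (G (x, t) - G (x, t')).
    by ring.
  rewrite (splitr e) (le_trans (ler_normB _ _)) // lerD //.
    exact: (AB (y, t')).
  by apply: (AB (x, t')); split => //; exact: nbhs_singleton.
by apply: filterS => y H t t01; apply: H; rewrite /= in_itv.
Qed.

Lemma is_derive_line (V : normedModType R) (f : V -> R) (a w : V) (s d : R) :
  is_derive (a + s *: w) w f d -> is_derive s 1 (fun s : R => f (a + s *: w)) d.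
Proof.
have E : (fun h : R => h^-1 *: (f (a + (h *: (1 : R) + s) *: w) - f (a + s *: w)))
       = (fun h => h^-1 *: (f (h *: w + (a + s *: w)) - f (a + s *: w))).
  apply/funext => h; congr (_ *: (f _ - _)).
  by rewrite [h *: _]mulr1 scalerDl addrCA.
move=> [df <-]; apply: DeriveDef; first by rewrite /derivable E.
by rewrite /derive E.
Qed.

Lemma mean_value_line (V : normedModType R) (f D : V -> R) (a w : V) :
  (forall s : R, 0 <= s <= 1 -> is_derive (a + s *: w) w f (D (a + s *: w))) ->
  exists2 c : R, 0 <= c <= 1 & f (a + w) - f a = D (a + c *: w).
Proof.
move=> df.
have dl (s : R) : 0 <= s <= 1 ->
    is_derive s 1 (fun s => f (a + s *: w)) (D (a + s *: w)).
  by move=> s01; apply: is_derive_line; exact: df.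
have [||c] := @MVT R (fun s => f (a + s *: w)) (fun s => D (a + s *: w)) 0 1 ltr01.
- by move=> s; rewrite in_itv /= => /andP[s0 s1]; apply: dl; rewrite !ltW.
- apply: derivable_within_continuous => s; rewrite in_itv /= => s01.
  exact: (@ex_derive _ _ _ _ _ _ _ (dl s s01)).
rewrite in_itv /= => /andP[c0 c1]; rewrite scale1r scale0r addr0 subr0 mulr1 => ->.
by exists c => //; rewrite !ltW.
Qed.

(** All directional derivatives near [x] are given by the same [J], so a single mean value on the
    segment from x to x + h suffices, instead of one per coordinate axis. *)
Lemma differentiable_partials m (f : 'rV[R]_m -> R) (J : 'I_m -> 'rV[R]_m -> R) x :
  (\forall y \near x, forall v, is_derive y v f (\sum_(j < m) v 0 j * J j y)) ->
  (forall j, {for x, continuous (J j)}) ->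
  differentiable f x.
Proof.
move=> df cJ; pose L (h : 'rV[R]_m) := \sum_(j < m) h 0 j * J j x.
have linL : linear L.
  move=> a u v; rewrite /L scaler_sumr -big_split; apply: eq_bigr => j _.
  by rewrite !mxE mulrDl /GRing.scale /= mulrA.
pose LM := GRing.isLinear.Build _ _ _ _ _ linL.
pose LL : {linear 'rV[R]_m -> R} := HB.pack L LM.
have cL : continuous LL.
  move=> h; have : Ck_on 0 setT L.
    apply: Ck_on_sum => [|j]; first exact: openT.
    apply: Ck_onM; [exact: openT| |exact: Ck_on_cst].
    exact: (smooth_on_coord j openT 0).
  exact.
suff fE : f \o shift x = cst (f x) + LL +o_ (0 : 'rV[R]_m) id.
  by apply/diff_locallyP; rewrite (diff_unique cL fE).
apply/eqaddoP => e e0.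
(* There are m summands, each allowed an error e / (m + 1); the successor keeps the denominator
   non-zero when m = 0. *)
pose P y := (forall v, is_derive y v f (\sum_(j < m) v 0 j * J j y)) /\
  forall j, `|J j x - J j y| <= e / m.+1%:R.
have em : 0 < e / m.+1%:R by rewrite divr_gt0.
have : \forall y \near x, P y.
  have nJ : \forall y \near x, forall j, `|J j x - J j y| <= e / m.+1%:R.
    apply: (@filter_forall _ _ (fun j y => `|J j x - J j y| <= e / m.+1%:R) _
      (nbhs_filter x)) => j.
    by have /cvgrPdist_le/(_ _ em) := cJ j.
  exact: filterI df nJ.
move=> /nbhs_ballP[d /= d0 dP].
have nd : \forall h \near (0 : 'rV[R]_m), `|h| < d by exact: nbhs0_lt.
near=> h.
have Ph (s : R) : 0 <= s <= 1 -> P (x + s *: h).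
  move=> /andP[s0 s1]; apply: dP; rewrite -ball_normE /= opprD addNKr normrN normrZ.
  rewrite ger0_norm //; apply: (@le_lt_trans _ _ `|h|); first by rewrite ler_piMl.
  by near: h.
have [c c01 E] := @mean_value_line _ f (fun y => \sum_(j < m) h 0 j * J j y) x h
  (fun s s01 => (Ph s s01).1 h).
rewrite !fctE /= [h + x]addrC opprD addrA E /L -sumrB.
apply: le_trans (ler_norm_sum _ _ _) _.
apply: (@le_trans _ _ (\sum_(j < m) `|h| * (e / m.+1%:R))).
  apply: ler_sum => j _; rewrite -mulrBr normrM ler_pM //.
    rewrite [leRHS]/Num.Def.normr /= mx_normrE.
    exact: (le_bigmax _ (fun i => `|h i.1 i.2|) (0, j)).
  by rewrite distrC; exact: (Ph c c01).2.
rewrite sumr_const card_ord -[leLHS]mulr_natr -mulrA mulrC ler_wpM2r //.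
by rewrite mulrAC ler_pdivrMr // ler_wpM2l ?ler_nat // ltW.
Unshelve. all: by end_near. Qed.

(** The weight [t ^+ k] closes the family under differentiation: each derivative in [x] brings out
    one factor [t]. *)
Definition ray m (k : nat) (y0 : 'rV[R]_m) (F : 'rV[R]_m -> R) (x : 'rV[R]_m) : R :=
  \int[mu]_(t in `[0, 1]) (t ^+ k * F (y0 + t *: (x - y0))).

Section Star.
Context (m : nat) (y0 : 'rV[R]_m) (U : set 'rV[R]_m).
Hypothesis oU : open U.
Hypothesis starU : forall x (t : R), U x -> 0 <= t <= 1 -> U (y0 + t *: (x - y0)).
Implicit Types (F : 'rV[R]_m -> R) (x v : 'rV[R]_m) (k : nat).

Let G k F (z : 'rV[R]_m * R) := z.2 ^+ k * F (y0 + z.2 *: (z.1 - y0)).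

Lemma continuous_ray_integrand k F x t : (forall y, U y -> {for y, continuous F}) ->
  U x -> 0 <= t <= 1 -> {for (x, t), continuous (G k F)}.
Proof.
move=> cF Ux t01; apply: cvgM.
  apply: (@continuous_comp _ _ _ snd (fun s : R => s ^+ k)); first exact: cvg_snd.
  exact: exprn_continuous.
apply: (@continuous_comp _ _ _ (fun z : 'rV[R]_m * R => y0 + z.2 *: (z.1 - y0)) F).
  apply: cvgD; first exact: cvg_cst.
  apply: cvgZ; first exact: cvg_snd.
  by apply: cvgB; [exact: cvg_fst|exact: cvg_cst].
exact/cF/starU.
Qed.

Lemma integrable_ray k F x : (forall y, U y -> {for y, continuous F}) -> U x ->
  mu.-integrable `[0, 1] (EFin \o (fun t => G k F (x, t))).
Proof.
move=> cF Ux; apply: continuous_compact_integrable; first exact: segment_compact.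
apply: continuous_in_subspaceT => t /set_mem; rewrite /= in_itv /= => t01.
apply: cvgM; first exact: exprn_continuous.
apply: (@continuous_comp _ _ _ (fun t : R => y0 + t *: (x - y0)) F).
  by apply: cvgD; [exact: cvg_cst|apply: cvgZr_tmp; exact: cvg_id].
exact/cF/starU.
Qed.


Lemma Rintegral_unit_dist (f g : R -> R) (e : R) :
  mu.-integrable `[0, 1] (EFin \o f) -> mu.-integrable `[0, 1] (EFin \o g) ->
  (forall t, 0 <= t <= 1 -> `|f t - g t| <= e) ->
  `|\int[mu]_(t in `[0, 1]) f t - \int[mu]_(t in `[0, 1]) g t| <= e.
Proof.
move=> intf intg fg.
have intB : mu.-integrable `[0, 1] (EFin \o (fun t => f t - g t)).
  by apply: integrableB intf intg.
rewrite -RintegralB //; apply: le_trans (le_normr_Rintegral _ intB) _ => //.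
apply: (@le_trans _ _ (\int[mu]_(t in `[0, 1]) e)).
  apply: le_Rintegral => //.
  - exact: integrable_norm.
  - apply: continuous_compact_integrable; first exact: segment_compact.
    by apply: continuous_subspaceT => ?; exact: cst_continuous.
by rewrite Rintegral_cst //= lebesgue_measure_itv /= lte_fin ltr01 oppr0 adde0 mulr1.
Qed.

Lemma continuous_ray k F x : (forall y, U y -> {for y, continuous F}) -> U x ->
  {for x, continuous (ray k y0 F)}.
Proof.
move=> cF Ux; apply/(@cvgrPdist_le _ _ _ _ (nbhs_filter x)) => e e0; near=> y.
have Uy : U y by near: y; exact: (open_nbhs_nbhs (conj oU Ux)).
apply: Rintegral_unit_dist; [exact: integrable_ray|exact: integrable_ray|].
near: y; apply: (@unif_continuous_unit _ (G k F) x) => // t.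
exact: continuous_ray_integrand.
Unshelve. all: by end_near. Qed.

(** For each [t] the difference quotient of the integrand is a mean value of its derivative at a
    point near [x]; the uniform estimate over [0, 1] then bounds the difference of the integrals. *)
Lemma is_derive_ray k F x v :
  (forall y, U y -> differentiable F y) ->
  (forall y, U y -> {for y, continuous ('D_v F)}) -> U x ->
  is_derive x v (ray k y0 F) (ray k.+1 y0 ('D_v F) x).
Proof.
move=> dF cDF Ux.
have cF y : U y -> {for y, continuous F}.
  by move=> Uy; exact/differentiable_continuous/dF.
suff lim_ray : h^-1 *: (ray k y0 F (h *: v + x) - ray k y0 F x) @[h --> 0^'] -->
    ray k.+1 y0 ('D_v F) x.
  by apply: DeriveDef; [apply/cvg_ex; eexists; exact: lim_ray|exact/cvg_lim].
apply/cvgrPdist_le => e e0.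
pose P y := U y /\ forall t : R, 0 <= t <= 1 ->
  `|G k.+1 ('D_v F) (x, t) - G k.+1 ('D_v F) (y, t)| <= e.
have nP : \forall y \near x, P y.
  apply: filterI; first exact: (open_nbhs_nbhs (conj oU Ux)).
  apply: (@unif_continuous_unit _ (G k.+1 ('D_v F)) x) => // t.
  exact: continuous_ray_integrand.
have nQ : \forall s \near (0 : R), P (x + s *: v).
  have cl : {for (0 : R), continuous (fun s : R => x + s *: v)}.
    apply: cvgD; first exact: cvg_cst.
    by apply: cvgZr_tmp; exact: cvg_id.
  by apply: cl; rewrite scale0r addr0.
move: nQ => /nbhs_ballP[d /= d0 dQ]; near=> h.
have h0 : h != 0 by near: h; exact: nbhs_dnbhs_neq.
have Ph (s : R) : 0 <= s <= 1 -> P (x + (s * h) *: v).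
  move=> /andP[s0 s1]; apply: dQ; rewrite -ball_normE /= sub0r normrN normrM.
  rewrite ger0_norm //; apply: (@le_lt_trans _ _ `|h|); first by rewrite ler_piMl.
  by near: h; exact: dnbhs0_lt.
have Uh : U (h *: v + x).
  by have := (Ph 1 _).1; rewrite mul1r addrC; apply; rewrite ler01 lexx.
have intB : mu.-integrable `[0, 1]
    (EFin \o (fun t => G k F (h *: v + x, t) - G k F (x, t))).
  by apply: integrableB (integrable_ray k cF Uh) (integrable_ray k cF Ux).
rewrite /ray -RintegralB //; [|exact: integrable_ray..].
rewrite [X in _ - X](_ : _ = \int[mu]_(t in `[0, 1])
    (h^-1 * (G k F (h *: v + x, t) - G k F (x, t)))); last first.
  by rewrite RintegralZl.
apply: Rintegral_unit_dist.
- exact: (integrable_ray k.+1 cDF Ux).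
- by apply: integrableZl h^-1 _ intB.
move=> t t01.
(* The intermediate point [c] depends on [t], which is harmless because the estimate in [P] is
   uniform in [t]. *)
have [c c01 E] : exists2 c : R, 0 <= c <= 1 &
    G k F (h *: v + x, t) - G k F (x, t) =
    h * G k.+1 ('D_v F) (x + (c * h) *: v, t).
  have [s s01|c c01 E] := @mean_value_line _ F
      (fun y => (t * h) * 'D_v F y) (y0 + t *: (x - y0)) ((t * h) *: v).
    have Us : U (y0 + t *: (x - y0) + s *: ((t * h) *: v)).
      have -> : y0 + t *: (x - y0) + s *: ((t * h) *: v) =
                y0 + t *: (x + (s * h) *: v - y0).
        apply/rowP => i; rewrite !mxE; ring.
      by apply: starU => //; exact: (Ph s s01).1.
    apply: DeriveDef; first exact/diff_derivable/dF.
    rewrite !deriveE; [|exact: dF..].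
    by rewrite linearZ.
  exists c => //; rewrite /G /= -mulrBr.
  have -> : y0 + t *: (h *: v + x - y0) = y0 + t *: (x - y0) + (t * h) *: v.
    by apply/rowP => i; rewrite !mxE; ring.
  rewrite E.
  have -> : y0 + t *: (x + (c * h) *: v - y0) =
            y0 + t *: (x - y0) + c *: ((t * h) *: v).
    by apply/rowP => i; rewrite !mxE; ring.
  by rewrite exprS; ring.
rewrite E mulKf //; exact: (Ph c c01).2.
Unshelve. all: by end_near. Qed.

End Star.
End Ray.

(** * Hadamard's lemma *)

Section Hadamard.
Context (R : realType).
Local Notation mu := (@lebesgue_measure R).

Lemma smooth_on_derive (V W : normedModType R) (U : set V) (f : V -> W) v :
  smooth_on U f -> smooth_on U ('D_v f).
Proof. by move=> Sf k; exact: (Sf k.+1).2. Qed.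

Section Star.
Context (m : nat) (y0 : 'rV[R]_m) (U : set 'rV[R]_m).
Hypothesis oU : open U.
Hypothesis starU : forall x (t : R), U x -> 0 <= t <= 1 -> U (y0 + t *: (x - y0)).
Implicit Types (F : 'rV[R]_m -> R) (x v : 'rV[R]_m) (k : nat).

Lemma ray_derive_sum k F x v : smooth_on U F -> U x ->
  ray k y0 ('D_v F) x = \sum_(j < m) v 0 j * ray k y0 ('D_(delta_mx 0 j) F) x.
Proof.
(* Arbitrary lists of indices allow an induction that uses additivity of the integral for two
   summands only. *)
move=> SF Ux; pose D (r : seq 'I_m) (y : 'rV[R]_m) :=
  \sum_(j <- r) v 0 j * 'D_(delta_mx 0 j) F y.
have CD l r : Ck_on l U (D r).
  apply: Ck_on_sum => // j; apply: Ck_onM => //; first exact: Ck_on_cst.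
  exact: (smooth_on_derive _ SF).
have cD r : mu.-integrable `[0, 1] (EFin \o (fun t : R => t ^+ k * D r (y0 + t *: (x - y0)))).
  exact: (integrable_ray starU k (CD 0%N r) Ux).
have intj j : mu.-integrable `[0, 1] (EFin \o (fun t : R =>
    t ^+ k * 'D_(delta_mx 0 j) F (y0 + t *: (x - y0)))).
  exact: (integrable_ray starU k (smooth_on_derive _ SF 0) Ux).
have rayD r : ray k y0 (D r) x = \sum_(j <- r) v 0 j * ray k y0 ('D_(delta_mx 0 j) F) x.
  elim: r => [|j r IH].
    rewrite big_nil /ray; under eq_Rintegral do rewrite /D big_nil mulr0.
    by rewrite Rintegral_cst //= mul0r.
  rewrite big_cons -IH /ray -RintegralZl // -RintegralD //.
    by apply: eq_Rintegral => t _; rewrite /D big_cons mulrDr mulrCA.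
  by apply: integrableZl (v 0 j) _ (intj j).
rewrite -rayD; apply: eq_Rintegral => t /set_mem; rewrite /= in_itv /= => t01.
by rewrite /D derive_row_sum //; apply: (SF 1%N).1; exact: starU.
Qed.

Lemma smooth_on_ray k F : smooth_on U F -> smooth_on U (ray k y0 F).
Proof.
move=> + l; elim: l k F => [|l IH] k F SF.
  move=> x Ux. exact: (continuous_ray oU starU (SF 0%N) Ux).
have dR x v : U x -> is_derive x v (ray k y0 F) (ray k.+1 y0 ('D_v F) x).
  move=> Ux.
  exact: (is_derive_ray oU starU k (SF 1%N).1 (smooth_on_derive v SF 0%N) Ux).
split=> [x Ux|v].
  apply: (@differentiable_partials _ _ _
    (fun j => ray k.+1 y0 ('D_(delta_mx 0 j) F))).
    apply: filterS (open_nbhs_nbhs (conj oU Ux)) => y Uy v.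
    by apply: is_derive_eq (dR y v Uy) _; rewrite ray_derive_sum.
  move=> j; exact: (continuous_ray oU starU (smooth_on_derive _ SF 0%N) Ux).
apply: Ck_on_ext (IH k.+1 _ (smooth_on_derive v SF)) => // x Ux.
by rewrite (@derive_val _ _ _ _ _ _ _ (dR x v Ux)).
Qed.

Lemma ray_fundamental F x : smooth_on U F -> U x ->
  F x - F y0 = ray 0 y0 ('D_(x - y0) F) x.
Proof.
move=> SF Ux.
have dl (s : R) : 0 <= s <= 1 -> is_derive s 1 (fun s => F (y0 + s *: (x - y0)))
    ('D_(x - y0) F (y0 + s *: (x - y0))).
  move=> s01; apply: is_derive_line; apply: DeriveDef => //.
  by apply/diff_derivable/(SF 1%N).1; exact: starU.
have cl (s : R) : 0 <= s <= 1 -> {for s, continuous (fun s : R => F (y0 + s *: (x - y0)))}.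
  move=> s01; apply: (@continuous_comp _ _ _ (fun t : R => y0 + t *: (x - y0)) F).
    by apply: cvgD; [exact: cvg_cst|apply: cvgZr_tmp; exact: cvg_id].
  by apply: (SF 0%N); exact: starU.
rewrite /ray; under eq_Rintegral do rewrite expr0 mul1r.
rewrite /Rintegral (@continuous_FTC2 _ _ (fun s => F (y0 + s *: (x - y0)))) //.
- by rewrite /= scale1r scale0r addr0 [y0 + _]addrC subrK.
- apply: continuous_in_subspaceT => t /set_mem; rewrite /= in_itv /= => t01.
  apply: (@continuous_comp _ _ _ (fun t : R => y0 + t *: (x - y0)) ('D_(x - y0) F)).
    by apply: cvgD; [exact: cvg_cst|apply: cvgZr_tmp; exact: cvg_id].
  by apply: (smooth_on_derive _ SF 0); exact: starU.
- split.
  + move=> s; rewrite in_itv /= => /andP[s0 s1].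
    by apply: (@ex_derive _ _ _ _ _ _ _ (dl s _)); rewrite !ltW.
  + by apply: cvg_at_right_filter; apply: cl; rewrite lexx ler01.
  + by apply: cvg_at_left_filter; apply: cl; rewrite lexx ler01.
- move=> s; rewrite in_itv /= => /andP[s0 s1].
  by rewrite derive1E (@derive_val _ _ _ _ _ _ _ (dl s _)) // !ltW.
Qed.

End Star.

(** The coefficient of index j is the integral of the j-th partial derivative along the ray from
    [y0]; a ball is star-shaped about its centre, so the rays stay inside. *)
Lemma hadamard m (y0 : 'rV[R]_m) (r : R) (F : 'rV[R]_m -> R) :
  0 < r -> smooth_on (ball y0 r) F ->
  exists g : 'I_m -> 'rV[R]_m -> R, [/\ forall j, smooth_on (ball y0 r) (g j),
    forall x, ball y0 r x -> F x = F y0 + \sum_(j < m) (x 0 j - y0 0 j) * g j x &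
    forall j, g j y0 = 'D_(delta_mx 0 j) F y0].
Proof.
move=> r0 SF.
have oB : open (ball y0 r) by exact: ball_open.
have sB x (t : R) : ball y0 r x -> 0 <= t <= 1 -> ball y0 r (y0 + t *: (x - y0)).
  rewrite -ball_normE /= => yx /andP[t0 t1].
  rewrite opprD addNKr normrN normrZ ger0_norm // -normrN opprB.
  by apply: le_lt_trans yx; rewrite ler_piMl.
exists (fun j => ray 0 y0 ('D_(delta_mx 0 j) F)); split.
- by move=> j; apply: smooth_on_ray => //; exact: smooth_on_derive.
- move=> x Bx; rewrite -[LHS](subrK (F y0)) addrC (ray_fundamental sB SF Bx).
  rewrite (ray_derive_sum oB sB) //; congr (_ + _); apply: eq_bigr => j _.
  by rewrite !mxE.
- move=> j; rewrite /ray; under eq_Rintegral do rewrite subrr scaler0 addr0 mul1r.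
  by rewrite Rintegral_cst //= lebesgue_measure_itv /= lte_fin ltr01 oppr0 adde0 mulr1.
Qed.

End Hadamard.

(** * Smooth functions and local frames *)

Section Algebra.
Context (R : realType) (m : nat) (M : manifold R m).
Implicit Types (f g : Cinf M) (X Y : vfield M).

Lemma Cinf_eqP f g : (forall p, f p = g p) -> f = g.
Proof. by move=> fg; apply/val_inj/funext. Qed.

Lemma vfield_eqP X Y : (forall f p, X f p = Y f p) -> X = Y.
Proof. by move=> XY; apply/val_inj/funext => f; exact: Cinf_eqP (XY f). Qed.

Lemma CinfDE f g p : (f + g) p = f p + g p. Proof. by []. Qed.

Lemma CinfNE f p : (- f) p = - f p. Proof. by []. Qed.

Lemma CinfME f g p : (f * g) p = f p * g p. Proof. by []. Qed.

Lemma Cinf_cstE r p : Cinf_cst M r p = r. Proof. by []. Qed.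

Lemma vfieldDE X Y f p : (X + Y) f p = X f p + Y f p. Proof. by []. Qed.

Lemma vfieldNE X f p : (- X) f p = - X f p. Proof. by []. Qed.

Lemma vfieldZE f X g p : (f *: X) g p = f p * X g p. Proof. by []. Qed.

Lemma Cinf_sumE (I : Type) (r : seq I) (F : I -> Cinf M) p :
  (\sum_(i <- r) F i : Cinf M) p = \sum_(i <- r) F i p.
Proof. exact: (big_morph (fun f : Cinf M => f p)). Qed.

Lemma vfield_sumE (I : Type) (r : seq I) (F : I -> vfield M) f :
  (\sum_(i <- r) F i : vfield M) f = \sum_(i <- r) F i f.
Proof. exact: (big_morph (fun X : vfield M => X f)). Qed.

Lemma vfieldP X : is_derivation X.
Proof. by case: X => D DP; exact/asboolP. Qed.

Lemma vfieldD X f g : X (f + g) = (X f : Cinf M) + X g.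
Proof. by case: (vfieldP X). Qed.

Lemma vfieldM X f g : X (f * g) = (X f : Cinf M) * g + f * X g.
Proof. by case: (vfieldP X). Qed.

Lemma vfieldZ X r f : X (Cinf_cst M r * f) = Cinf_cst M r * X f.
Proof. by case: (vfieldP X). Qed.

Lemma vfield1 X : X 1 = 0.
Proof.
apply: (addrI (X 1)); rewrite addr0 -[RHS](congr1 X (mulr1 1)) vfieldM.
by rewrite mulr1 mul1r.
Qed.

Lemma vfield_cst X r : X (Cinf_cst M r) = 0.
Proof. by rewrite -[Cinf_cst M r]mulr1 vfieldZ vfield1 mulr0. Qed.

Lemma vfield0 X : X 0 = 0.
Proof. by apply: (addrI (X 0)); rewrite -vfieldD !addr0. Qed.

Lemma vfieldN X f : X (- f) = - (X f : Cinf M).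
Proof.
have -> : - f = Cinf_cst M (-1) * f by apply: Cinf_eqP => p /=; rewrite mulN1r.
by rewrite vfieldZ; apply: Cinf_eqP => p /=; rewrite mulN1r.
Qed.

Lemma vfieldB X f g : X (f - g) = (X f : Cinf M) - X g.
Proof. by rewrite vfieldD vfieldN. Qed.

Lemma vfield_sum X (I : Type) (r : seq I) (F : I -> Cinf M) :
  X (\sum_(i <- r) F i) = \sum_(i <- r) (X (F i) : Cinf M).
Proof.
exact: (big_morph (fun f => X f : Cinf M) (vfieldD X) (vfield0 X)).
Qed.

End Algebra.

(* Generalizing over the matched term, instead of rewriting with the lemma, keeps
   the matching syntactic: the unifier diverges on the alternatives by unfolding
   the algebraic structures of [Cinf] and [vfield]. *)
Ltac eval_with e r H := generalize (H : e = r); generalize e; intros ? ->.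
Ltac evaluate := repeat match goal with
  | |- context [Cinf_fun (vfield_fun (@Algebra.add ?s ?X ?Y) ?f) ?p] =>
    eval_with (Cinf_fun (vfield_fun (@Algebra.add s X Y) f) p) (X f p + Y f p) (vfieldDE X Y f p)
  | |- context [Cinf_fun (vfield_fun (@Algebra.opp ?s ?X) ?f) ?p] =>
    eval_with (Cinf_fun (vfield_fun (@Algebra.opp s X) f) p) (- X f p) (vfieldNE X f p)
  | |- context [Cinf_fun (vfield_fun (@GRing.scale ?s ?t ?h ?X) ?f) ?p] =>
    eval_with (Cinf_fun (vfield_fun (@GRing.scale s t h X) f) p) (h p * X f p) (vfieldZE h X f p)
  | |- context [Cinf_fun (@Algebra.add ?s ?f ?g) ?p] =>
    eval_with (Cinf_fun (@Algebra.add s f g) p) (f p + g p) (CinfDE f g p)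
  | |- context [Cinf_fun (@Algebra.opp ?s ?f) ?p] =>
    eval_with (Cinf_fun (@Algebra.opp s f) p) (- f p) (CinfNE f p)
  | |- context [Cinf_fun (@GRing.mul ?s ?f ?g) ?p] =>
    eval_with (Cinf_fun (@GRing.mul s f g) p) (f p * g p) (CinfME f g p)
  end.

(** * Bump functions and extension by zero from a chart *)

Section Bump.
Context (R : realType).

(** The vanishing is recorded through a compact [K] because compactness passes to the image of [K]
    in the manifold, which is what extension by zero requires. *)
Lemma bump_row m (x : 'rV[R]_m) (r : R) : 0 < r ->
  exists (G : 'rV[R]_m -> R) (K : set 'rV[R]_m),
  [/\ smooth_on setT G, G x != 0, compact K, K `<=` ball x r &
      forall y, ~ K y -> G y = 0].
Proof.
(* Balls of row vectors are those of the sup norm, which is not smooth; the squared Euclidean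
   distance [q] is smooth and dominates the square of each coordinate difference. *)
move=> r0; pose q (y : 'rV[R]_m) := \sum_(j < m) (y 0 j - x 0 j) ^+ 2.
have Sq : smooth_on setT q.
  move=> k; apply: Ck_on_sum => [|j]; first exact: openT.
  have C1 : Ck_on k setT (fun y : 'rV[R]_m => y 0 j - x 0 j).
    apply: (Ck_onD openT (smooth_on_coord j openT k)).
    exact: (Ck_on_cst k setT (- x 0 j)).
  by apply: Ck_on_ext openT _ (Ck_onM openT C1 C1) => y _; rewrite expr2.
pose K := [set y | q y <= (r / 2) ^+ 2].
have Kx y j : K y -> `|y 0 j - x 0 j| <= r / 2.
  have r20 : 0 <= r / 2 by rewrite divr_ge0 // ltW.
  move=> Ky; rewrite -(@ler_pXn2r _ 2) ?nnegrE // real_normK ?num_real //.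
  apply: le_trans _ Ky.
  by rewrite /q (bigD1 j) //= lerDl sumr_ge0 // => i _; rewrite sqr_ge0.
have KB y : K y -> `|x - y| <= r / 2.
  move=> Ky; rewrite [leLHS]/Num.Def.normr /= mx_normrE bigmax_le //.
    by rewrite divr_ge0 // ltW.
  by move=> [i j] _; rewrite !mxE (ord1 i) distrC; exact: Kx.
exists (fun y => flat 0 ((r / 2) ^+ 2 - q y)), K; split.
- move=> k; apply: (Ck_on_comp_real openT (smooth_flat R 0)).
  apply: (Ck_onD openT (Ck_on_cst k setT ((r / 2) ^+ 2))).
  apply: Ck_on_ext openT _ (Ck_onM openT (Ck_on_cst k setT (- 1 : R)) (Sq k)) => y _.
  by rewrite /= mulN1r.
- have -> : q x = 0 by rewrite /q big1 // => j _; rewrite subrr expr0n.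
  by rewrite subr0 /flat exprn_gt0 ?divr_gt0 // expr0 mul1r gt_eqF // expR_gt0.
- apply: bounded_closed_compact.
    exists (`|x| + r / 2); split; first exact: num_real.
    move=> t xt y /KB xy; apply: le_trans (ltW xt).
    by rewrite -[y](subrK x) addrC (le_trans (ler_normD _ _)) // lerD2l distrC.
  apply: (@preimage_closed _ _ q [set s | s <= (r / 2) ^+ 2]); last exact: closed_le.
  by move=> y _; exact: (Sq 0%N).
- move=> y /KB xy; rewrite -ball_normE /=; apply: le_lt_trans xy _.
  by rewrite ltr_pdivrMr // ltr_pMr // ltr1n.
- move=> y Ky; rewrite /flat ifF //; apply/negbTE; rewrite -leNgt subr_le0 ltW //.
  by rewrite ltNge; apply/negP.
Qed.

Lemma open_preimage (S T : topologicalType) (A : set S) (B : set T) (f : S -> T) :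
  open A -> open B -> (forall x, A x -> {for x, continuous f}) ->
  open (A `&` f @^-1` B).
Proof.
move=> oA oB cf; rewrite openE => x [Ax Bx]; apply: filterI.
  exact: (open_nbhs_nbhs (conj oA Ax)).
by apply: (cf x Ax); exact: (open_nbhs_nbhs (conj oB Bx)).
Qed.

Context (m : nat) (M : manifold R m).

Definition chart_lift (c : chart R m M) (G : 'rV[R]_m -> R) (p : M) : R :=
  if `[< chart_dom c p >] then G (chart_map c p) else 0.

Lemma chart_lift_in c G p : chart_dom c p -> chart_lift c G p = G (chart_map c p).
Proof. by move=> cp; rewrite /chart_lift asboolT. Qed.

Lemma chart_lift_out c G p : ~ chart_dom c p -> chart_lift c G p = 0.
Proof. by move=> cp; rewrite /chart_lift asboolF. Qed.

(** Near the image of [K] the lift is [G] read through a transition map. Away from it the lift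
    vanishes on a neighbourhood, since a compact subset of a Hausdorff space is closed. *)
Lemma chart_lift_smooth c G (U K : set 'rV[R]_m) : atlas c -> open U ->
  U `<=` chart_map c @` chart_dom c -> smooth_on U G -> compact K -> K `<=` U ->
  (forall y, ~ K y -> G y = 0) -> chart_lift c G \in smooth_pred (M := M).
Proof.
move=> ac oU Uc SG cK KU G0; apply/asboolP => c' ac' k.
have closedK : closed (chart_inv c @` K).
  apply: compact_closed; first exact: manifold_hausdorff.
  apply: continuous_compact => //; apply: continuous_in_subspaceT => y /set_mem Ky.
  exact/chart_inv_continuous/Uc/KU.
have oc' : open (chart_map c' @` chart_dom c') by exact: chart_img_open.
apply: Ck_on_local => _ [q c'q <-].
have [[y Ky yq]|nKq] := pselect ((chart_inv c @` K) q).
  have [p cp py] := Uc y (KU y Ky).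
  have qp : q = p by rewrite -yq -py chart_mapK.
  pose O := chart_dom c `&` chart_map c @^-1` U.
  have oO : open O.
    by apply: open_preimage => //; [exact: chart_dom_open|exact: chart_map_continuous].
  exists ((chart_map c' @` chart_dom c') `&` chart_inv c' @^-1` O).
    by split; [exists q|rewrite /= chart_mapK // qp /O /= py; split => //; exact: KU].
  have oA := open_preimage oc' oO (@chart_inv_continuous _ _ _ c').
  apply: (@Ck_on_ext _ _ _ _ _ (G \o (chart_map c \o chart_inv c'))) => //.
    by move=> z [_ [cz _]]; rewrite /= chart_lift_in.
  apply: (Ck_on_comp_row oA _ (SG k)); first by move=> z [_ []].
  apply: Ck_on_sub (atlas_compatible ac' ac k) => z [[s c's sz] [cz _]].
  by exists s => //; split => //; rewrite -(chart_mapK c's) sz.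
have oO : open (~` (chart_inv c @` K)) by rewrite openC.
exists ((chart_map c' @` chart_dom c') `&` chart_inv c' @^-1` (~` (chart_inv c @` K))).
  by split; [exists q|rewrite /= chart_mapK].
have oA := open_preimage oc' oO (@chart_inv_continuous _ _ _ c').
apply: Ck_on_ext oA _ (Ck_on_cst k _ 0) => z [_ nKz] /=.
have [cz|cz] := pselect (chart_dom c (chart_inv c' z)); last by rewrite chart_lift_out.
rewrite chart_lift_in // G0 // => Kz; apply: nKz; exists (chart_map c (chart_inv c' z)) => //.
exact: chart_mapK.
Qed.

End Bump.

(** * Vector fields in a chart and local frames *)

Section LocalFrame.
Context (R : realType) (m : nat) (M : manifold R m).

Lemma near_chart (c : chart R m M) p : chart_dom c p ->
  \forall y \near chart_map c p, (chart_map c @` chart_dom c) y.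
Proof.
move=> cp; apply: open_nbhs_nbhs; split; first exact: chart_img_open.
by exists p.
Qed.

Lemma chart_ball (c : chart R m M) p : chart_dom c p ->
  exists2 r : R, 0 < r & ball (chart_map c p) r `<=` chart_map c @` chart_dom c.
Proof. by move=> /near_chart/nbhs_ballP[r /= r0 rc]; exists r. Qed.

Lemma Cinf_differentiable (c : chart R m M) (f : Cinf M) p : atlas c ->
  chart_dom c p -> differentiable (f \o chart_inv c) (chart_map c p).
Proof.
case: f => f /= Sf ac cp; have {}Sf : smooth f by exact/asboolP.
by apply: (Sf c ac 1%N).1; exists p.
Qed.

Section Derivation.
Context (c : chart R m M) (ac : atlas c) (v : 'rV[R]_m).
Context (G : 'rV[R]_m -> R) (K : set 'rV[R]_m).
Hypothesis SG : smooth_on setT G.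
Hypothesis cK : compact K.
Hypothesis Kc : K `<=` chart_map c @` chart_dom c.
Hypothesis G0 : forall y, ~ K y -> G y = 0.

Lemma chart_lift_derive_smooth (f : Cinf M) :
  chart_lift c (G * 'D_v (f \o chart_inv c)) \in smooth_pred (M := M).
Proof.
have oc := @chart_img_open _ _ _ c.
apply: (chart_lift_smooth ac oc _ _ cK) => // [k|y nKy].
  apply: Ck_onM => //; first exact: Ck_on_sub (SG k).
  case: f => f /= Sf; have {}Sf : smooth f by exact/asboolP.
  exact: (smooth_on_derive v (Sf c ac)).
by rewrite fctE G0 // mul0r.
Qed.

Definition chart_derivation (f : Cinf M) : (Cinf M)^o :=
  MkCinf (chart_lift_derive_smooth f).

Lemma chart_derivationE f p : chart_dom c p ->
  chart_derivation f p = G (chart_map c p) * 'D_v (f \o chart_inv c) (chart_map c p).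
Proof. by move=> cp; rewrite /= chart_lift_in. Qed.

Lemma chart_derivation_out f p : ~ chart_dom c p -> chart_derivation f p = 0.
Proof. by move=> cp; rewrite /= chart_lift_out. Qed.

Lemma chart_derivation_subproof : chart_derivation \in derivation_pred (M := M).
Proof.
have D (f : Cinf M) p : chart_dom c p ->
    derivable (f \o chart_inv c) (chart_map c p) v.
  by move=> cp; exact/diff_derivable/Cinf_differentiable.
apply/asboolP; split=> [r f|f g|f g]; apply: Cinf_eqP => p;
  rewrite ?CinfDE ?CinfME;
  (have [cp|cp] := pselect (chart_dom c p); last by
    rewrite !chart_derivation_out // ?mulr0 ?mul0r ?addr0); rewrite !chart_derivationE //.
- have -> : Cinf_cst M r * f \o chart_inv c = r *: (f \o chart_inv c) by [].
  by rewrite deriveZ; [exact: mulrCA|exact: D].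
- have -> : f + g \o chart_inv c = (f \o chart_inv c) + (g \o chart_inv c) by [].
  by rewrite deriveD; [exact: mulrDr|exact: D|exact: D].
- have -> : f * g \o chart_inv c = (f \o chart_inv c) * (g \o chart_inv c) by [].
  rewrite deriveM; [|exact: D|exact: D]; rewrite /= chart_mapK // /GRing.scale /=; ring.
Qed.

Definition chart_vfield : vfield M := MkVfield chart_derivation_subproof.

Lemma chart_lift_bump_smooth (F : 'rV[R]_m -> R) (U : set 'rV[R]_m) :
  open U -> K `<=` U -> U `<=` chart_map c @` chart_dom c -> smooth_on U F ->
  chart_lift c (G * F) \in smooth_pred (M := M).
Proof.
move=> oU KU Uc SF; apply: (chart_lift_smooth ac oU Uc _ cK) => // [k|y nKy].
  by apply: Ck_onM => //; exact: Ck_on_sub (SG k).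
by rewrite fctE G0 // mul0r.
Qed.

End Derivation.

(* A derivation at [q] is determined by the differential at [q]: by Hadamard's
   lemma, [rho^2 (f - f q)] is a sum of products of two functions, the first
   of which is a cut-off coordinate vanishing at [q]. *)
Lemma vfield_chart (c : chart R m M) (X : vfield M) (f : Cinf M) (G : 'rV[R]_m -> R)
    (chi : Cinf M) (u : 'I_m -> Cinf M) q :
  atlas c -> chart_dom c q ->
  (forall p, chart_dom c p -> chi p = G (chart_map c p)) ->
  (forall j p, chart_dom c p -> u j p = G (chart_map c p) * chart_map c p 0 j) ->
  chi q * chi q * X f q = \sum_(j < m) (chi q * X (u j) q - u j q * X chi q) *
     'D_(delta_mx 0 j) (f \o chart_inv c) (chart_map c q).
Proof.
move=> ac cq chiE uE; set y := chart_map c q.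
have oc := @chart_img_open _ _ _ c.
have [r r0 rc] := chart_ball cq.
have Sf : smooth_on (ball y r) (f \o chart_inv c).
  case: f => f /= Sf k; have {}Sf : smooth f by exact/asboolP.
  exact: Ck_on_sub rc (Sf c ac k).
have [g [Sg fg gy]] := hadamard r0 Sf.
(* The Hadamard coefficients live only on the ball; multiplied by [H], a bump centred at the image
   of [q], they become global functions to which [X] applies. *)
have [H [K [SH Hy cK Kr H0]]] := bump_row y r0.
have Kc : K `<=` chart_map c @` chart_dom c by exact: subset_trans rc.
pose L F U oU KU Uc SF := MkCinf (@chart_lift_bump_smooth c ac H K SH cK H0 F U oU KU Uc SF).
have oB : open (ball y r) by exact: ball_open.
have Sw j : smooth_on (chart_map c @` chart_dom c) (fun z : 'rV[R]_m => z 0 j - y 0 j).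
  move=> k; apply: (Ck_onD oc (smooth_on_coord j oc k)).
  exact: (Ck_on_cst k _ (- y 0 j)).
have S1 : smooth_on (chart_map c @` chart_dom c) (cst 1 : 'rV[R]_m -> R).
  by move=> k; exact: Ck_on_cst.
have [rho [rhoE rho_out]] : exists rho : Cinf M,
    (forall p, chart_dom c p -> rho p = H (chart_map c p)) /\
    forall p, ~ chart_dom c p -> rho p = 0.
  exists (L _ _ oc Kc (@subset_refl _ _) S1); split=> p cp; last exact: chart_lift_out.
  by rewrite /= chart_lift_in // fctE mulr1.
have [w [wE w_out]] : exists w : 'I_m -> Cinf M, (forall j p, chart_dom c p ->
    w j p = H (chart_map c p) * (chart_map c p 0 j - y 0 j)) /\
    forall j p, ~ chart_dom c p -> w j p = 0.
  exists (fun j => L _ _ oc Kc (@subset_refl _ _) (Sw j)).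
  by split=> j p cp; [exact: chart_lift_in|exact: chart_lift_out].
have [gg ggE] : exists gg : 'I_m -> Cinf M,
    forall j p, chart_dom c p -> gg j p = H (chart_map c p) * g j (chart_map c p).
  exists (fun j => L _ _ oB Kr rc (Sg j)).
  by move=> j p cp; exact: chart_lift_in.
have out p : ~ chart_dom c p -> rho p = 0 /\ forall j, w j p = 0.
  by move=> cp; split=> [|j]; [exact: rho_out|exact: w_out].
have rhof : rho * rho * f = rho * rho * Cinf_cst M (f q) + \sum_(j < m) w j * gg j.
  apply: Cinf_eqP => p; rewrite CinfDE !CinfME Cinf_sumE.
  have [cp|/out[r_ w_]] := pselect (chart_dom c p); last first.
    by rewrite r_ !mul0r add0r big1 // => j _; rewrite CinfME w_ mul0r.
  have [Kp|nKp] := pselect (K (chart_map c p)); last first.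
    rewrite rhoE // H0 // !mul0r add0r big1 // => j _.
    by rewrite CinfME wE // H0 // !mul0r.
  have ff := fg _ (Kr _ Kp); rewrite /= !chart_mapK // in ff.
  rewrite ff Cinf_cstE rhoE // mulrDr mulr_sumr; congr (_ + _); apply: eq_bigr => j _.
  by rewrite CinfME wE // ggE // -/y; ring.
(* The cut-off in [w] depends on [q], while [chi] and [u] do not. This identity eliminates [w] and
   leaves chi X(u_j) - u_j X(chi), formally chi^2 X(x_j). *)
have chiw j : chi * w j = rho * (u j - Cinf_cst M (y 0 j) * chi).
  apply: Cinf_eqP => p; rewrite !(CinfME, CinfDE, CinfNE, Cinf_cstE).
  have [cp|/out[r_ w_]] := pselect (chart_dom c p).
    by rewrite wE // rhoE // chiE // uE //; ring.
  by rewrite r_ w_ mul0r mulr0.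
have rho0 : rho q != 0 by rewrite rhoE.
have wq j : w j q = 0 by rewrite wE // subrr mulr0.
have Xw j : chi q * X (w j) q = rho q * (X (u j) q - y 0 j * X chi q).
  have := congr1 (fun h : Cinf M => X h q) (chiw j).
  rewrite !vfieldM vfieldB vfieldZ !(CinfME, CinfDE, CinfNE, Cinf_cstE) wq.
  rewrite uE // chiE // -/y => E.
  by rewrite -[LHS]add0r -[X in X + _](mulr0 (X chi q)) E; ring.
have Xf : rho q * X f q = \sum_(j < m) X (w j) q *
    'D_(delta_mx 0 j) (f \o chart_inv c) y.
  apply: (mulfI rho0).
  have := congr1 (fun h : Cinf M => X h q) rhof.
  rewrite vfieldD vfield_sum !vfieldM vfield_cst.
  rewrite !(CinfME, CinfDE, CinfNE, Cinf_cstE) Cinf_sumE mulr0 addr0 => /addrI.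
  rewrite mulrA => ->; rewrite mulr_sumr; apply: eq_bigr => j _.
  by rewrite vfieldM CinfDE !CinfME wq mul0r addr0 ggE // -/y gy rhoE //; ring.
apply: (mulfI rho0); rewrite mulrCA Xf !mulr_sumr; apply: eq_bigr => j _.
rewrite -!mulrA [chi q * (X (w j) q * _)]mulrA Xw uE // -chiE // -/y; ring.
Qed.

(** In the chart E_j is chi d_j and th_j is chi^2 dx_j, whence om = chi^3. Nothing is divided by
    [chi], which has zeros, so the relations hold between global objects. *)
Lemma local_frame p : exists (om : Cinf M) (E : 'I_m -> vfield M)
    (th : 'I_m -> vfield M -> Cinf M),
  [/\ om p != 0, forall X, om *: X = \sum_(j < m) th j X *: E j,
      forall i j, th j (E i) = om *+ (i == j),
      forall j f X Y, th j (f *: X + Y) = f * th j X + th j Y &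
      forall j X q, tangent_eq q X 0 -> th j X q = 0].
Proof.
have [c ac cp] := atlas_cover p.
have oc := @chart_img_open _ _ _ c.
have [r r0 rc] := chart_ball cp.
have [G [K [SG Gp cK Kr G0]]] := bump_row (chart_map c p) r0.
have Kc : K `<=` chart_map c @` chart_dom c by exact: subset_trans rc.
have S1 : smooth_on (chart_map c @` chart_dom c) (cst 1 : 'rV[R]_m -> R).
  by move=> k; exact: Ck_on_cst.
pose L F SF := MkCinf
  (@chart_lift_bump_smooth c ac G K SG cK G0 F _ oc Kc (@subset_refl _ _) SF).
pose chi : Cinf M := L _ S1.
pose u j : Cinf M := L _ (smooth_on_coord j oc).
have chiE q : chart_dom c q -> chi q = G (chart_map c q).
  by move=> cq; rewrite /= chart_lift_in // fctE mulr1.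
have uE j q : chart_dom c q -> u j q = G (chart_map c q) * chart_map c q 0 j.
  by move=> cq; rewrite /= chart_lift_in.
pose E j := chart_vfield ac (delta_mx 0 j) SG cK Kc G0.
have EE j f q : chart_dom c q ->
    E j f q = chi q * 'D_(delta_mx 0 j) (f \o chart_inv c) (chart_map c q).
  by move=> cq; rewrite chiE // [LHS]chart_derivationE.
have out q : ~ chart_dom c q -> [/\ chi q = 0, forall j, u j q = 0 & forall j f, E j f q = 0].
  by move=> cq; split=> [|j|j f]; rewrite /= chart_lift_out.
(* The coordinate x_j is not a global function but chi x_j is: [th] is the quotient rule for x_j =
   u_j / chi, cleared of its denominator. *)
clearbody chi u E; pose th j (X : vfield M) : Cinf M := chi * X (u j) - u j * X chi.
exists (chi * chi * chi), E, th; split.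
- by rewrite !CinfME !mulf_neq0 // chiE.
- move=> X; apply: vfield_eqP => f q; rewrite vfieldZE vfield_sumE Cinf_sumE.
  have [cq|/out[c0 u0 E0]] := pselect (chart_dom c q); last first.
    by rewrite !CinfME c0 !mul0r big1 // => j _; rewrite vfieldZE E0 mulr0.
  rewrite !CinfME (_ : _ * X f q = chi q * (chi q * chi q * X f q)); last by ring.
  rewrite (vfield_chart X f ac cq chiE uE).
  rewrite mulr_sumr; apply: eq_bigr => j _.
  by rewrite vfieldZE EE // CinfDE CinfNE !CinfME mulrCA.
- move=> i j; apply: Cinf_eqP => q.
  have -> : (chi * chi * chi *+ (i == j)) q = (chi q * chi q * chi q) *+ (i == j).
    by case: (i == j).
  rewrite CinfDE CinfNE !CinfME.
  have [cq|/out[c0 u0 E0]] := pselect (chart_dom c q); last first.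
    by rewrite c0 u0 !mul0r subr0 mul0rn.
  rewrite !EE // uE // -!chiE //.
  have nc := near_chart cq.
  have dG : differentiable G (chart_map c q) by exact: (SG 1%N).1.
  have dc : differentiable (fun z : 'rV[R]_m => z 0 j) (chart_map c q).
    exact: differentiable_coord.
  rewrite (@near_eq_derive _ _ _ (u j \o chart_inv c) (G * (fun z => z 0 j))); last first.
    by apply: filterS nc => _ [s cs <-]; rewrite /= chart_mapK // uE.
  rewrite (@near_eq_derive _ _ _ (chi \o chart_inv c) G); last first.
    by apply: filterS nc => _ [s cs <-]; rewrite /= chart_mapK // chiE.
  rewrite deriveM; [|exact: diff_derivable|exact: diff_derivable].
  have -> : 'D_(delta_mx 0 i) (fun z : 'rV[R]_m => z 0 j) (chart_map c q) = (i == j)%:R.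
    have := @derive_mx _ _ _ _ id (chart_map c q) (delta_mx 0 i) (@derivable_id _ _ _ _).
    rewrite derive_id => /(congr1 (fun A : 'rV[R]_m => A 0 j)); rewrite !mxE => <-.
    by rewrite eqxx eq_sym.
  by rewrite /GRing.scale /= -chiE // -[RHS]mulr_natr; ring.
- move=> j f X Y; apply: Cinf_eqP => q.
  by rewrite /th !(CinfDE, CinfNE, CinfME, vfieldDE, vfieldZE); ring.
- move=> j X q X0; rewrite CinfDE CinfNE !CinfME.
  by rewrite -[X (u j) q]/(_) -[X chi q]/(_) !X0 !mulr0 subrr.
Qed.

End LocalFrame.

(** * Traces of endomorphisms *)

Section Trace.
Context (R : realType) (m : nat) (M : manifold R m).
Local Notation X_M := (vfield M).
Implicit Types (T A : X_M -> X_M) (f : Cinf M) (X Y : X_M).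

Lemma linear_sumE (T : X_M -> X_M) : linear T ->
  forall (I : Type) (r : seq I) (F : I -> X_M),
  T (\sum_(i <- r) F i) = \sum_(i <- r) T (F i).
Proof.
move=> lT I r F; pose TM := GRing.isLinear.Build _ _ _ _ _ lT.
pose TL : {linear X_M -> X_M} := HB.pack T TM.
exact: (linear_sum TL).
Qed.

Lemma linear_ZE (T : X_M -> X_M) : linear T -> forall f X, T (f *: X) = f *: T X.
Proof.
move=> lT f X; pose TM := GRing.isLinear.Build _ _ _ _ _ lT.
pose TL : {linear X_M -> X_M} := HB.pack T TM.
exact: (linearZZ TL).
Qed.

Lemma form_sumE (th : X_M -> Cinf M) :
  (forall f X Y, th (f *: X + Y) = f * th X + th Y) ->
  forall (I : Type) (r : seq I) (F : I -> X_M),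
  th (\sum_(i <- r) F i) = \sum_(i <- r) th (F i).
Proof.
move=> lth I r F.
have th0 : th 0 = 0.
  by have := lth (-1) 0 0; rewrite scaler0 addr0 mulN1r addNr.
by apply: big_morph => // X Y; rewrite -[X]scale1r lth mul1r scale1r.
Qed.

Lemma form_ZE (th : X_M -> Cinf M) :
  (forall f X Y, th (f *: X + Y) = f * th X + th Y) ->
  forall f X, th (f *: X) = f * th X.
Proof.
move=> lth f X; have th0 : th 0 = 0.
  by have := lth (-1) 0 0; rewrite scaler0 addr0 mulN1r addNr.
by rewrite -[f *: X]addr0 lth th0 addr0.
Qed.

(* On [om <> 0], [E] is a frame with dual coframe [th / om]. *)
Record coframe (om : Cinf M) (E : 'I_m -> X_M) (th : 'I_m -> X_M -> Cinf M) : Prop :=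
  Coframe {
  coframe_span : forall X, om *: X = \sum_(j < m) th j X *: E j;
  coframe_dual : forall i j, th j (E i) = om *+ (i == j);
  coframe_linear : forall j f X Y, th j (f *: X + Y) = f * th j X + th j Y;
  coframe_tangent : forall j X q, tangent_eq q X 0 -> th j X q = 0 }.

Lemma coframe_at (p : M) : exists (om : Cinf M) E th, om p != 0 /\ coframe om E th.
Proof.
by have [om [E [th [om0 H1 H2 H3 H4]]]] := @local_frame R m M p; exists om, E, th.
Qed.

Section Coframe.
Context (om : Cinf M) (E : 'I_m -> X_M) (th : 'I_m -> X_M -> Cinf M).
Hypothesis cf : coframe om E th.
Let span := coframe_span cf.
Let dual := coframe_dual cf.
Let thl := coframe_linear cf.

Lemma coframe_map T X : linear T -> om *: T X = \sum_(j < m) th j X *: T (E j).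
Proof.
move=> lT; rewrite -linear_ZE // span linear_sumE //.
by apply: eq_bigr => j _; rewrite linear_ZE.
Qed.

Lemma coframe_form (al : X_M -> Cinf M) X :
  (forall f X Y, al (f *: X + Y) = f * al X + al Y) ->
  om * al X = \sum_(j < m) th j X * al (E j).
Proof.
move=> lal; rewrite -form_ZE // span form_sumE //.
by apply: eq_bigr => j _; rewrite form_ZE.
Qed.

(** The relation holds at [q] only; it transfers because the value of a coframe at [q] sees only the
    tangent vector there ([coframe_tangent]). *)
Lemma coframe_comb (a : 'I_m -> R) (Z : X_M) (F : 'I_m -> X_M) q :
  (forall f, Z f q = \sum_(i < m) a i * F i f q) ->
  forall k, th k Z q = \sum_(i < m) a i * th k (F i) q.
Proof.
move=> ZE k; pose W := (- \sum_(i < m) Cinf_cst M (a i) *: F i).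
have : tangent_eq q (1 *: Z + W) 0.
  move=> f; rewrite vfieldDE vfieldZE vfieldNE vfield_sumE Cinf_sumE ZE mul1r.
  by rewrite subrr.
move=> /(coframe_tangent cf k); rewrite thl mul1r /W CinfDE.
rewrite -scaleN1r form_ZE // form_sumE // mulN1r CinfNE Cinf_sumE.
move=> /eqP; rewrite subr_eq0 => /eqP ->; apply: eq_bigr => i _.
by rewrite form_ZE.
Qed.

Lemma coframe_frame q : om q != 0 -> frame_at q E.
Proof.
move=> om0 a a0 k; have := @coframe_comb a 0 E q _ k.
have -> : th k 0 = 0 by rewrite -(scale0r 0) form_ZE // mul0r.
move=> /(_ (fun f => esym (a0 f)))/esym.
rewrite (bigD1 k) //= big1 => [|i ik]; last by rewrite dual (negbTE ik) mulr0n mulr0.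
by rewrite dual eqxx mulr1n addr0 => /eqP; rewrite mulf_eq0 (negbTE om0) orbF => /eqP.
Qed.

(** [xget] must return this number: any other admissible frame yields a matrix conjugate to the one
    of the coframe, hence of equal trace. *)
Lemma trace_coframe T q : linear T -> om q != 0 ->
  om q * trace T q = \sum_(j < m) th j (T (E j)) q.
Proof.
move=> lT om0; pose A0 := \matrix_(i < m, j < m) th i (T (E j)) q.
have mA : matrix_at q E T ((om q)^-1 *: A0).
  move=> j f; apply: (mulfI om0); rewrite mulr_sumr.
  have := congr1 (fun X : X_M => X f q) (span (T (E j))).
  rewrite vfieldZE vfield_sumE Cinf_sumE => ->; apply: eq_bigr => i _.
  by rewrite vfieldZE !mxE mulrA mulrA mulfV // mul1r.
have -> : trace T q = \tr ((om q)^-1 *: A0).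
  apply: xget_unique.
    by exists E, ((om q)^-1 *: A0); split=> //; exact: coframe_frame.
  move=> t [E' [A' [fE' mA' ->]]].
  (* Up to the factor [om q], [B] is the change of basis from [E'] to [E]. A vector in its kernel
     would be a linear relation between the [E'] at [q]. *)
  pose B := \matrix_(i < m, j < m) th i (E' j) q.
  have BA : om q *: (B *m A') = A0 *m B.
    apply/matrixP => k j; rewrite !mxE.
    transitivity (om q * th k (T (E' j)) q).
      congr (_ * _); rewrite (coframe_comb (mA' j)).
      by apply: eq_bigr => i _; rewrite !mxE mulrC.
    rewrite -CinfME -form_ZE // coframe_map // form_sumE // Cinf_sumE.
    by apply: eq_bigr => i _; rewrite form_ZE // !mxE mulrC.
  have uB : B \in unitmx.
    rewrite unitmxE unitfE -det_tr; apply/negP => /det0P[v v0 vB].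
    move/negP: v0; apply; apply/eqP/rowP => k; rewrite mxE.
    apply: (fE' (fun j => v 0 j)) => f; apply: (mulfI om0); rewrite mulr0 mulr_sumr.
    transitivity (\sum_(j < m) \sum_(i < m) v 0 j * th i (E' j) q * E i f q).
      apply: eq_bigr => j _; rewrite mulrCA -vfieldZE span vfield_sumE.
      by rewrite Cinf_sumE mulr_sumr; apply: eq_bigr => i _; rewrite vfieldZE mulrA.
    rewrite exchange_big big1 //= => i _; rewrite -mulr_suml.
    have := congr1 (fun w : 'rV_m => w 0 i) vB; rewrite !mxE => vBi.
    rewrite (_ : \sum_(j < m) _ = 0) ?mul0r // -[RHS]vBi.
    by apply: eq_bigr => j _; rewrite !mxE.
  have -> : A' = (om q)^-1 *: (invmx B *m (A0 *m B)).
    by rewrite -BA -scalemxAr scalerA mulVf // scale1r mulKmx.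
  by rewrite !mxtraceZ mxtrace_mulC -mulmxA mulmxV // mulmx1.
by rewrite mxtraceZ mulrA mulfV // mul1r; apply: eq_bigr => j _; rewrite !mxE.
Qed.

End Coframe.
End Trace.

(** * Rules for traces: cyclicity, skew endomorphisms, differentiation *)

Section TraceTheory.
Context (R : realType) (m : nat) (M : manifold R m).
Local Notation X_M := (vfield M).
Implicit Types (T A : X_M -> X_M) (f : Cinf M) (X Y : X_M).

Lemma trace_comb f T A p : linear T -> linear A ->
  trace (fun X => f *: T X + A X) p = f p * trace T p + trace A p.
Proof.
move=> lT lA; have [om [E [th [om0 cf]]]] := coframe_at p.
have lTA : linear (fun X => f *: T X + A X).
  move=> h X Y; rewrite lT lA !scalerDr !scalerA mulrC -!scalerA; exact: addrACA.
apply: (mulfI om0); rewrite (trace_coframe cf) // mulrDr mulrCA !(trace_coframe cf) //.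
rewrite mulr_sumr -big_split; apply: eq_bigr => j _.
by rewrite /= (coframe_linear cf).
Qed.

Lemma linear_scale f A : linear A -> linear (fun X => f *: A X).
Proof. by move=> lA h X Y; rewrite lA scalerDr !scalerA [f * h]mulrC. Qed.

Lemma linear_add T A : linear T -> linear A -> linear (fun X => T X + A X).
Proof. by move=> lT lA h X Y; rewrite lT lA scalerDr addrACA. Qed.

Lemma linear_opp A : linear A -> linear (fun X => - A X).
Proof. by move=> lA h X Y; rewrite lA opprD scalerN. Qed.

Lemma trace_add T A p : linear T -> linear A ->
  trace (fun X => T X + A X) p = trace T p + trace A p.
Proof.
move=> lT lA; rewrite -[trace T p]mul1r -[1]/((1 : Cinf M) p) -(trace_comb 1 p lT lA).
by congr (trace _ p); apply/funext => X; rewrite scale1r.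
Qed.

Lemma trace_zero p : trace (fun _ : X_M => 0) p = 0.
Proof.
have l0 : linear (fun _ : X_M => 0 : X_M) by move=> f X Z; rewrite scaler0 addr0.
have := trace_add p l0 l0.
under [X in trace X p]eq_fun do rewrite addr0.
by move=> /eqP; rewrite -subr_eq0 opprD addNKr oppr_eq0 => /eqP.
Qed.

Lemma trace_scale f A p : linear A -> trace (fun X => f *: A X) p = f p * trace A p.
Proof.
have l0 : linear (fun _ : X_M => 0 : X_M) by move=> h X Z; rewrite scaler0 addr0.
move=> lA; rewrite -[RHS]addr0 -(trace_zero p) -(trace_comb f p lA l0).
by congr (trace _ p); apply/funext => X; rewrite addr0.
Qed.

Lemma trace_opp A p : linear A -> trace (fun X => - A X) p = - trace A p.
Proof.
move=> lA; have := trace_scale (- 1) p lA; rewrite CinfNE mulN1r => <-.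
by congr (trace _ p); apply/funext => X; rewrite scaleN1r.
Qed.

(** After two multiplications by [om], both traces expand into the same double sum over the
    coframe. *)
Lemma trace_comp T A p : linear T -> linear A ->
  trace (fun X => T (A X)) p = trace (fun X => A (T X)) p.
Proof.
have key T' A' om E th : linear T' -> linear A' -> @coframe R m M om E th ->
    om p * \sum_(j < m) th j (T' (A' (E j))) p =
    \sum_(i < m) \sum_(j < m) th i (A' (E j)) p * th j (T' (E i)) p.
  move=> lT lA cf; rewrite mulr_sumr exchange_big; apply: eq_bigr => j _.
  rewrite -CinfME -(form_ZE (coframe_linear cf _)) -linear_ZE //.
  rewrite (coframe_span cf) linear_sumE // (form_sumE (coframe_linear cf _)) Cinf_sumE.
  by apply: eq_bigr => i _; rewrite linear_ZE // (form_ZE (coframe_linear cf _)).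
move=> lT lA; have [om [E [th [om0 cf]]]] := coframe_at p.
have lTA : linear (fun X => T (A X)) by move=> h X Y; rewrite lA lT.
have lAT : linear (fun X => A (T X)) by move=> h X Y; rewrite lT lA.
apply: (mulfI om0); rewrite !(trace_coframe cf) //; apply: (mulfI om0).
rewrite (key T A om E th lT lA cf) (key A T om E th lA lT cf).
rewrite exchange_big; apply: eq_bigr => i _; apply: eq_bigr => j _.
exact: mulrC.
Qed.

Lemma trace_rank1 (al : X_M -> Cinf M) X p :
  (forall f X Y, al (f *: X + Y) = f * al X + al Y) ->
  trace (fun Z => al Z *: X) p = al X p.
Proof.
move=> lal; have [om [E [th [om0 cf]]]] := coframe_at p.
have lT : linear (fun Z => al Z *: X).
  by move=> h Y Z; rewrite lal scalerDl scalerA.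
apply: (mulfI om0); rewrite (trace_coframe cf) // -CinfME (coframe_form cf) // Cinf_sumE.
by apply: eq_bigr => j _; rewrite (form_ZE (coframe_linear cf _)) mulrC.
Qed.

Lemma trace_id p : trace (fun X : X_M => X) p = m%:R.
Proof.
have [om [E [th [om0 cf]]]] := coframe_at p.
apply: (mulfI om0); rewrite (trace_coframe cf) //.
rewrite (eq_bigr (fun=> om p)) => [|j _]; last by rewrite (coframe_dual cf) eqxx.
by rewrite sumr_const card_ord mulr_natr.
Qed.

(** The frame is not orthonormal, so the Gram matrix [G] enters: the matrix of [A] is the product of
    the inverse of [G] and a skew matrix, and its trace equals its opposite. Positivity of the
    metric makes [G] invertible. *)
Lemma trace_skew (g : X_M -> X_M -> Cinf M) A p : riemannian_metric g -> linear A ->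
  (forall X Y, g (A X) Y = - g X (A Y)) -> trace A p = 0.
Proof.
move=> rg lA skew; have [om [E [th [om0 cf]]]] := coframe_at p.
have gl Y f X Z : g (f *: X + Z) Y = f * g X Y + g Z Y by exact: metric_linear.
pose G := \matrix_(i < m, j < m) g (E i) (E j) p.
pose N := \matrix_(i < m, j < m) (om p * g (E i) (A (E j)) p).
pose a := \matrix_(i < m, j < m) th i (A (E j)) p.
have Ga : G *m a = N.
  apply/matrixP => k j; rewrite !mxE (Defs.metric_sym rg) -CinfME.
  rewrite -(form_ZE (gl _)) (coframe_span cf) (form_sumE (gl _)) Cinf_sumE.
  apply: eq_bigr => i _; rewrite !mxE (form_ZE (gl _)) CinfME mulrC.
  by rewrite (Defs.metric_sym rg).
have uG : G \in unitmx.
  rewrite unitmxE unitfE; apply/negP => /det0P[v v0 vG].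
  pose Z := \sum_(i < m) Cinf_cst M (v 0 i) *: E i.
  have ZE f : Z f p = \sum_(i < m) v 0 i * E i f p.
    by rewrite vfield_sumE Cinf_sumE.
  have gZ : g Z Z p = 0.
    rewrite {1}/Z (form_sumE (gl _)) Cinf_sumE.
    transitivity (\sum_(i < m) \sum_(j < m) v 0 j * (v 0 i * G i j)).
      apply: eq_bigr => i _; rewrite (form_ZE (gl _)) (Defs.metric_sym rg) /Z.
      rewrite (form_sumE (gl _)) CinfME Cinf_sumE mulr_sumr.
      apply: eq_bigr => j _; rewrite (form_ZE (gl _)) CinfME Cinf_cstE (Defs.metric_sym rg).
      by rewrite !mxE mulrCA.
    rewrite exchange_big big1 //= => j _; rewrite -mulr_sumr.
    have := congr1 (fun w : 'rV_m => w 0 j) vG; rewrite !mxE => ->.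
    by rewrite mulr0.
  have : ~ tangent_eq p Z 0.
    move=> Z0; move/negP: v0; apply; apply/eqP/rowP => k; rewrite mxE.
    by apply: (coframe_frame cf om0) => f; rewrite -ZE Z0.
  by move=> /(metric_pos rg); rewrite gZ ltxx.
have GT : G^T = G by apply/matrixP => i j; rewrite !mxE (Defs.metric_sym rg).
have NT : N^T = - N.
  apply/matrixP => i j; rewrite !mxE (Defs.metric_sym rg) skew CinfNE.
  by rewrite mulrN.
have a_tr : \tr a = - \tr a.
  rewrite -{1}mxtrace_tr -[a](mulKmx uG) Ga trmx_mul NT trmx_inv GT mulNmx.
  by rewrite raddfN /= mxtrace_mulC.
apply: (mulfI om0); rewrite (trace_coframe cf) // mulr0.
have -> : \sum_(j < m) th j (A (E j)) p = \tr a.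
  by apply: eq_bigr => j _; rewrite mxE.
lra.
Qed.

(* [D] plays the role of a covariant derivative along [xi]. *)
Lemma trace_derivative (xi : X_M) (D : X_M -> X_M) T (s : Cinf M) p :
  (forall X Y, D (X + Y) = D X + D Y) ->
  (forall f X, D (f *: X) = (xi f : Cinf M) *: X + f *: D X) ->
  linear T -> (forall q, trace T q = s q) ->
  trace (fun X => D (T X) - T (D X)) p = xi s p.
Proof.
move=> DD DZ lT sE; have [om [E [th [om0 cf]]]] := coframe_at p.
have thD k X Y : th k (X + Y) = th k X + th k Y.
  by rewrite -[X]scale1r (coframe_linear cf) mul1r scale1r.
have thZ k := form_ZE (coframe_linear cf k).
have thN k X : th k (- X) = - th k X by rewrite -scaleN1r thZ mulN1r.
have lB : linear (fun X => D (T X) - T (D X)).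
  move=> f X Y; apply: vfield_eqP => h q.
  rewrite lT !DD !DZ -[xi f *: X + _ + _]addrA !lT.
  by rewrite !(vfieldDE, vfieldNE, vfieldZE); ring.
pose sg := \sum_(j < m) th j (T (E j)).
(* This is the derivative of the one-form [th i] along [xi]. Unlike [D] it is linear over functions,
   so it can be expanded in the coframe. *)
pose psi i X : Cinf M := xi (th i X) - th i (D X).
have psil i f X Y : psi i (f *: X + Y) = f * psi i X + psi i Y.
  apply: Cinf_eqP => q; rewrite /psi DD DZ (coframe_linear cf) vfieldD vfieldM.
  rewrite !thD !thZ !(CinfDE, CinfNE, CinfME); ring.
have psiD i X : psi i X p + th i (D X) p = xi (th i X) p by exact: subrK.
(* The additional factor [om] makes the identity true at the zeros of [om] as well, so it is an
   identity of functions and [xi] may be applied to it. *)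
have sgE : om * om * s = om * sg.
  apply: Cinf_eqP => q; rewrite !CinfME.
  have [->|q0] := eqVneq (om q) 0; first by rewrite !mul0r.
  by rewrite -mulrA -sE (trace_coframe cf) // /sg Cinf_sumE.
have sgp : sg p = om p * s p.
  apply: (mulfI om0); have := congr1 (fun h : Cinf M => h p) sgE.
  by rewrite !CinfME mulrA => <-.
have xsg : xi sg p = xi om p * s p + om p * xi s p.
  apply: (mulfI om0); have := congr1 (fun h : Cinf M => xi h p) sgE.
  rewrite /= !vfieldM !(CinfDE, CinfME) sgp => E1; apply: (addrI (xi om p * (om p * s p))).
  by rewrite -E1; ring.
(* The terms from differentiating the coframe and the frame combine into derivatives of th_j(E_i),
   that is of [om] or 0; only xi(om) remains. *)
have xsg2 : om p * xi sg p = om p * (\sum_(j < m) th j (D (T (E j)) - T (D (E j))) p) +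
    xi om p * sg p.
  have -> : om p * xi sg p = om p * (\sum_(j < m) th j (D (T (E j)) - T (D (E j))) p) +
    \sum_(j < m) (om * (psi j (T (E j)) + th j (T (D (E j))))) p.
    rewrite /sg vfield_sum Cinf_sumE !mulr_sumr -big_split; apply: eq_bigr => j _.
    rewrite [X in _ = _ + X](_ : _ = om p * (xi (th j (T (E j))) p -
      th j (D (T (E j))) p + th j (T (D (E j))) p)) //.
    by rewrite thD thN CinfDE CinfNE; ring.
  congr (_ + _).
  transitivity (\sum_(j < m) \sum_(i < m)
      th i (T (E j)) p * (psi j (E i) p + th j (D (E i)) p)).
    under [RHS]eq_bigr do (under eq_bigr do rewrite mulrDr; rewrite big_split).
    rewrite big_split /= [X in _ = _ + X]exchange_big -big_split.
    apply: eq_bigr => j _.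
    transitivity ((om * psi j (T (E j))) p + (om * th j (T (D (E j)))) p).
      by rewrite !CinfME -mulrDr.
    congr (_ + _).
      rewrite (coframe_form cf _ (psil j)) Cinf_sumE.
      by apply: eq_bigr => i _; rewrite CinfME.
    rewrite -thZ (coframe_map cf) // (form_sumE (coframe_linear cf _)) Cinf_sumE.
    by apply: eq_bigr => i _; rewrite thZ CinfME mulrC.
  rewrite /sg Cinf_sumE mulr_sumr; apply: eq_bigr => j _.
  rewrite (bigD1 j) //= big1 => [|i ij].
    by rewrite addr0 psiD (coframe_dual cf) eqxx mulrC.
  rewrite psiD (coframe_dual cf) (negbTE ij) mulr0n.
  by rewrite vfield0 mulr0.
apply: (mulfI om0); rewrite (trace_coframe cf) //; apply: (mulfI om0).
move: xsg2; rewrite xsg sgp => E1.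
by apply: (addIr (xi om p * (om p * s p))); rewrite -E1; ring.
Qed.

End TraceTheory.

(** * Kenmotsu geometry *)

Section Metric.
Context (R : realType) (m : nat) (M : manifold R m).
Local Notation X_M := (vfield M).
Implicit Types (f : Cinf M) (X Y Z W : X_M).
Context (g : X_M -> X_M -> Cinf M) (rg : riemannian_metric g).

Lemma metricZl f X Z : g (f *: X) Z = f * g X Z.
Proof. exact: (form_ZE (fun f X Y => Defs.metric_linear rg f X Y Z)). Qed.

Lemma metricDl X Y Z : g (X + Y) Z = g X Z + g Y Z.
Proof. by rewrite -[X]scale1r (Defs.metric_linear rg) mul1r scale1r. Qed.

Lemma metricNl X Z : g (- X) Z = - g X Z.
Proof. by rewrite -scaleN1r metricZl mulN1r. Qed.

Lemma metricZr f X Z : g X (f *: Z) = f * g X Z.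
Proof. by rewrite !(Defs.metric_sym rg X) metricZl. Qed.

Lemma metricDr X Y Z : g Z (X + Y) = g Z X + g Z Y.
Proof. by rewrite !(Defs.metric_sym rg Z) metricDl. Qed.

Lemma metricNr X Z : g Z (- X) = - g Z X.
Proof. by rewrite !(Defs.metric_sym rg Z) metricNl. Qed.

Lemma metric_eq0_at X p : g X X p = 0 -> tangent_eq p X 0.
Proof.
move=> gX; have [//|nX] := pselect (tangent_eq p X 0).
by have := metric_pos rg nX; rewrite gX ltxx.
Qed.

Lemma metric_nondegenerate X Y : (forall Z, g X Z = g Y Z) -> X = Y.
Proof.
move=> gXY; apply: vfield_eqP => f p.
have : tangent_eq p (X - Y) 0.
  by apply: metric_eq0_at; rewrite metricDl metricNl gXY subrr.
by move=> /(_ f)/eqP; rewrite vfieldDE vfieldNE subr_eq0 => /eqP.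
Qed.

Context (nabla : X_M -> X_M -> X_M) (hnabla : levi_civita g nabla).

Lemma nablaDr X Y Z : nabla X (Y + Z) = nabla X Y + nabla X Z.
Proof. exact: (connection_add hnabla). Qed.

Lemma nablaZr f X Y : nabla X (f *: Y) = (X f : Cinf M) *: Y + f *: nabla X Y.
Proof. exact: (connection_leibniz hnabla). Qed.

Lemma nabla0r X : nabla X 0 = 0.
Proof. by apply: (addrI (nabla X 0)); rewrite -nablaDr !addr0. Qed.

Lemma nablaNr X Y : nabla X (- Y) = - nabla X Y.
Proof. by apply: (addrI (nabla X Y)); rewrite -nablaDr !subrr nabla0r. Qed.

Lemma nablaDl X Y Z : nabla (X + Y) Z = nabla X Z + nabla Y Z.
Proof. by rewrite -[X]scale1r (connection_linear hnabla) !scale1r. Qed.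

Lemma nabla0l Z : nabla 0 Z = 0.
Proof. by apply: (addrI (nabla 0 Z)); rewrite -nablaDl !addr0. Qed.

Lemma nablaNl X Z : nabla (- X) Z = - nabla X Z.
Proof. by apply: (addrI (nabla X Z)); rewrite -nablaDl !subrr nabla0l. Qed.

Lemma nablaZl f X Z : nabla (f *: X) Z = f *: nabla X Z.
Proof. by rewrite -[f *: X]addr0 (connection_linear hnabla) nabla0l addr0. Qed.

Lemma bracketE X Y : lie_bracket X Y = nabla X Y - nabla Y X.
Proof. by rewrite (connection_torsion_free hnabla). Qed.

Lemma bracket_fun X Y f : lie_bracket X Y f = (X (Y f) : Cinf M) - Y (X f).
Proof. by []. Qed.

Lemma nabla_metric X Y Z : X (g Y Z) = g (nabla X Y) Z + g Y (nabla X Z).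
Proof. exact: (connection_metric hnabla). Qed.

Definition metricE := (metricDl, metricDr, metricNl, metricNr, metricZl, metricZr).
Definition nablaE := (nablaDl, nablaDr, nablaNl, nablaNr, nablaZl, nablaZr).

Local Notation K := (curvature nabla).

Lemma curvature_bracket X Y Z :
  K X Y Z = nabla X (nabla Y Z) - nabla Y (nabla X Z)
            - (nabla (nabla X Y) Z - nabla (nabla Y X) Z).
Proof. by rewrite /curvature bracketE nablaDl nablaNl. Qed.

Lemma curvature_skew X Y Z : K X Y Z = - K Y X Z.
Proof. by rewrite !curvature_bracket; apply: vfield_eqP => f p; evaluate; ring. Qed.

Lemma curvature_linear3 X Y : linear (K X Y).
Proof.
move=> f Z W; rewrite /curvature !nablaE; apply: vfield_eqP => h p.
by rewrite bracket_fun; evaluate; ring.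
Qed.

Lemma curvature_linear1 Y Z : linear (fun X => K X Y Z).
Proof.
move=> f X W; rewrite !curvature_bracket !nablaE.
by apply: vfield_eqP => h p; evaluate; ring.
Qed.

Lemma curvature_linear2 X Z : linear (fun Y => K X Y Z).
Proof.
move=> f Y W; rewrite !(curvature_skew X) curvature_linear1.
by rewrite opprD scalerN.
Qed.

Lemma jacobi X Y Z : lie_bracket X (lie_bracket Y Z) + lie_bracket Y (lie_bracket Z X)
  + lie_bracket Z (lie_bracket X Y) = 0.
Proof.
apply: vfield_eqP => f p; evaluate; rewrite !bracket_fun !vfieldB; evaluate.
by rewrite -[RHS](subrr 0); ring.
Qed.

Lemma bianchi1 X Y Z : K X Y Z + K Y Z X + K Z X Y = 0.
Proof.
(* Zero is replaced by the Jacobi sum: once torsion-freeness expands the brackets, both sides are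
   the same combination of iterated covariant derivatives. *)
rewrite -(jacobi X Y Z) /curvature.
apply: vfield_eqP => f p.
rewrite [lie_bracket X (lie_bracket Y Z)]bracketE.
rewrite [lie_bracket Y (lie_bracket Z X)]bracketE.
rewrite [lie_bracket Z (lie_bracket X Y)]bracketE.
rewrite !(bracketE, nablaE); evaluate; ring.
Qed.

(** The bracket of X and Y acts on g(Z, W) as the commutator of derivations; expanding both by
    metric compatibility leaves the curvature terms. *)
Lemma curvature_metric X Y Z W : g (K X Y Z) W = - g Z (K X Y W).
Proof.
have : lie_bracket X Y (g Z W) = (X (Y (g Z W)) : Cinf M) - Y (X (g Z W)) by [].
rewrite !nabla_metric !vfieldD !nabla_metric => E.
apply: Cinf_eqP => p; have := congr1 (fun h : Cinf M => h p) E.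
by rewrite /curvature !metricE; evaluate => E1; lra.
Qed.

(** The classical octahedron argument: four instances of the first Bianchi identity, combined
    through the two skew symmetries. *)
Lemma curvature_pair X Y Z W : g (K X Y Z) W = g (K Z W X) Y.
Proof.
apply: Cinf_eqP => p.
have B A1 A2 A3 A4 : g (K A1 A2 A3) A4 p + g (K A2 A3 A1) A4 p + g (K A3 A1 A2) A4 p = 0.
  rewrite -[RHS](_ : g 0 A4 p = 0); last by rewrite -(scale0r 0) metricZl mul0r.
  by rewrite -(bianchi1 A1 A2 A3) !metricE.
have s12 A1 A2 A3 A4 : g (K A1 A2 A3) A4 p = - g (K A2 A1 A3) A4 p.
  by rewrite curvature_skew metricNl.
have s34 A1 A2 A3 A4 : g (K A1 A2 A3) A4 p = - g (K A1 A2 A4) A3 p.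
  by rewrite curvature_metric (Defs.metric_sym rg).
have := B X Y Z W; have := B Y Z W X; have := B Z W X Y; have := B W X Y Z.
have := s34 Y Z W X; have := s34 Z W Y X; have := s12 W Y Z X; have := s34 Y W Z X.
have := s34 W X Z Y; have := s12 X Z W Y; have := s34 Z X W Y; have := s34 X Y W Z.
lra.
Qed.

End Metric.

(** * The second Bianchi identity *)

Section Bianchi2.
Context (R : realType) (m : nat) (M : manifold R m).
Local Notation X_M := (vfield M).
Implicit Types (f : Cinf M) (X Y Z W : X_M).
Context (g : X_M -> X_M -> Cinf M) (rg : riemannian_metric g).
Context (nabla : X_M -> X_M -> X_M) (hnabla : levi_civita g nabla).

Definition cov_deriv (K : X_M -> X_M -> X_M -> X_M) W X Y Z : X_M :=
  nabla W (K X Y Z) - K (nabla W X) Y Z - K X (nabla W Y) Z - K X Y (nabla W Z).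

Local Notation K := (curvature nabla).

Lemma bianchi2 W X Y Z :
  cov_deriv K W X Y Z + cov_deriv K X Y W Z + cov_deriv K Y W X Z = 0.
Proof.
(* What remains after cancellation is minus the covariant derivative of Z along the Jacobi sum of W,
   X, Y, so zero is put in that form beforehand. *)
rewrite -(oppr0 X_M) -(nabla0l hnabla Z) -(jacobi W X Y) /cov_deriv /curvature.
apply: vfield_eqP => f p.
rewrite [lie_bracket W (lie_bracket X Y)](bracketE hnabla).
rewrite [lie_bracket X (lie_bracket Y W)](bracketE hnabla).
rewrite [lie_bracket Y (lie_bracket W X)](bracketE hnabla).
rewrite !(bracketE hnabla, nablaE hnabla); evaluate; ring.
Qed.

End Bianchi2.

(** * Kenmotsu structures and the transverse Kaehler symmetries of [hyp_dev] *)

Section Kenmotsu.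
Context (R : realType) (m : nat) (M : manifold R m).
Local Notation X_M := (vfield M).
Context (phi : X_M -> X_M) (xi : X_M) (eta : X_M -> Cinf M) (g : X_M -> X_M -> Cinf M).
Context (nabla : X_M -> X_M -> X_M).
Implicit Types (f : Cinf M) (X Y Z W : X_M).

(* Stated over plain functions, rather than over the record
   [almost_contact_metric], so that [phi] and [eta] are opaque to unification. *)
Record kenmotsu_structure : Prop := KenmotsuStructure {
  ks_metric : riemannian_metric g;
  ks_nabla : levi_civita g nabla;
  ks_phi_linear : linear phi;
  ks_eta_linear : forall f X Y, eta (f *: X + Y) = f * eta X + eta Y;
  ks_phi2 : forall X, phi (phi X) = - X + eta X *: xi;
  ks_eta_xi : eta xi = 1;
  ks_compatible : forall X Y, g (phi X) (phi Y) = g X Y - eta X * eta Y;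
  ks_nabla_phi : forall X Y, nabla X (phi Y) =
    phi (nabla X Y) + (g (phi X) Y *: xi - eta Y *: phi X) }.

Hypothesis ks : kenmotsu_structure.
Let rg := ks_metric ks.
Let hnabla := ks_nabla ks.
Let phi2 := ks_phi2 ks.
Let eta_xi := ks_eta_xi ks.
Let nabla_phi := ks_nabla_phi ks.

Let etaZ f X : eta (f *: X) = f * eta X.
Proof. exact: (form_ZE (ks_eta_linear ks)). Qed.

Let etaD X Y : eta (X + Y) = eta X + eta Y.
Proof. by rewrite -[X]scale1r (ks_eta_linear ks) mul1r scale1r. Qed.

Let etaN X : eta (- X) = - eta X.
Proof. by rewrite -scaleN1r etaZ mulN1r. Qed.

Let eta0 : eta 0 = 0.
Proof. by rewrite -(scale0r 0) etaZ mul0r. Qed.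

Let phiZ f X : phi (f *: X) = f *: phi X.
Proof. exact: (linear_ZE (ks_phi_linear ks)). Qed.

Let phiD X Y : phi (X + Y) = phi X + phi Y.
Proof. by rewrite -[X]scale1r (ks_phi_linear ks) !scale1r. Qed.

Let phiN X : phi (- X) = - phi X.
Proof. by rewrite -scaleN1r phiZ scaleN1r. Qed.

Let phi0 : phi 0 = 0.
Proof. by have := phiZ 0 0; rewrite !scale0r. Qed.

(** Evaluating phi^3 xi shows that phi xi = eta(phi xi) xi; applying [phi] and then [eta] shows that
    eta(phi xi) has square zero. The ring of functions is not a domain, but it is reduced, as seen
    at each point. *)
Lemma phi_xi : phi xi = 0.
Proof.
have phi2_xi : phi (phi xi) = 0 by rewrite phi2 eta_xi scale1r addNr.
have := phi2 (phi xi); rewrite phi2_xi phi0 => /esym/eqP.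
rewrite addrC subr_eq0 => /eqP E.
have e0 : eta (phi xi) = 0.
  apply: Cinf_eqP => p; apply/eqP; rewrite -[_ == _]/(_ == 0) -sqrf_eq0 expr2; apply/eqP.
  have := congr1 (fun X => eta (phi X) p) E; rewrite phiZ etaZ CinfME phi2_xi.
  by move=> ->; rewrite eta0.
by rewrite -E e0 scale0r.
Qed.

Lemma g_xi X : g X xi = eta X.
Proof.
have := ks_compatible ks X xi; rewrite phi_xi eta_xi mulr1.
have -> : g (phi X) 0 = 0 by rewrite -(scale0r 0) (metricZr rg) mul0r.
by move=> /esym/eqP; rewrite subr_eq0 => /eqP.
Qed.

Lemma eta_phi X : eta (phi X) = 0.
Proof.
have := congr1 phi (phi2 X).
rewrite phi2 phiD phiN phiZ phi_xi scaler0 => /addrI/(congr1 eta).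
by rewrite etaZ eta_xi mulr1 eta0.
Qed.

Lemma phi_skew X Y : g (phi X) Y = - g X (phi Y).
Proof.
have := ks_compatible ks X (phi Y); rewrite eta_phi mulr0 subr0 phi2 => <-.
by rewrite (metricDr rg) (metricNr rg) (metricZr rg) g_xi eta_phi mulr0 addr0 opprK.
Qed.

Lemma g_xil X : g xi X = eta X.
Proof. by rewrite (Defs.metric_sym rg) g_xi. Qed.

Lemma g_phi_swap X Y : g X (phi Y) = - g Y (phi X).
Proof. by rewrite -phi_skew (Defs.metric_sym rg). Qed.

(** The Kenmotsu identity with Y = xi determines the part transverse to [xi], and differentiating
    g(xi, xi) = 1 kills the other. *)
Lemma nabla_xi X : nabla X xi = X - eta X *: xi.
Proof.
have E : phi (nabla X xi) = phi X.
  have := nabla_phi X xi; rewrite phi_xi (nabla0r hnabla) g_xi eta_phi scale0r.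
  by rewrite eta_xi scale1r add0r => /esym/eqP; rewrite subr_eq0 => /eqP.
have e0 : eta (nabla X xi) = 0.
  apply: Cinf_eqP => p; have := nabla_metric hnabla X xi xi.
  rewrite g_xi eta_xi vfield1.
  rewrite (Defs.metric_sym rg xi) !g_xi => /(congr1 (fun h : Cinf M => h p)).
  rewrite CinfDE => H.
  have {}H : 0 = eta (nabla X xi) p + eta (nabla X xi) p :> R by exact: H.
  by suff : eta (nabla X xi) p = 0 :> R by []; lra.
have := congr1 phi E; rewrite !phi2 e0 scale0r addr0 => /eqP.
by rewrite eqr_oppLR opprD opprK => /eqP.
Qed.

Lemma vfield_eta X Y : X (eta Y) = eta (nabla X Y) + (g X Y - eta X * eta Y).
Proof.
rewrite -[in LHS](g_xi Y) (nabla_metric hnabla) g_xi nabla_xi.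
by rewrite (metricDr rg) (metricNr rg) (metricZr rg) g_xi (Defs.metric_sym rg Y).
Qed.

Local Notation K := (curvature nabla).

(* The deviation of the curvature from that of constant curvature -1.  It
   behaves like the curvature of a Kaehler manifold transverse to [xi]. *)
Definition hyp_dev X Y Z : X_M := K X Y Z + (g Y Z *: X - g X Z *: Y).

Local Notation T := hyp_dev.

Let contactE := (etaD, etaN, etaZ, eta_xi, eta_phi, phiD, phiN, phiZ, phi_xi, phi2).

(** Differentiating [nabla_xi] once more gives R(X, Y) xi = eta(X) Y - eta(Y) X, which the
    correction in [hyp_dev] cancels. *)
Lemma hyp_dev_xi3 X Y : T X Y xi = 0.
Proof.
rewrite /T (curvature_bracket hnabla) !g_xi !nabla_xi !(nablaE hnabla) !nabla_xi.
apply: vfield_eqP => f p; rewrite !vfield_eta (Defs.metric_sym rg Y X).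
evaluate.
by rewrite -[RHS]/(0 : R); ring.
Qed.

(** Differentiating the Kenmotsu identity computes the commutator of R(X, Y) with [phi]; it is
    non-zero, and the metric terms of [hyp_dev] compensate it exactly. *)
Lemma hyp_dev_phi X Y Z : T X Y (phi Z) = phi (T X Y Z).
Proof.
rewrite /T !(curvature_bracket hnabla) !nabla_phi !(nablaE hnabla) !nabla_phi !nabla_xi.
rewrite !contactE !vfield_eta !(nabla_metric hnabla) !nabla_phi.
apply: vfield_eqP => f p.
rewrite !(metricE rg) !phi_skew !g_xil (g_phi_swap Y X); evaluate.
ring.
Qed.

Lemma hyp_dev_skew X Y Z : T X Y Z = - T Y X Z.
Proof.
by rewrite /T (curvature_skew hnabla X); apply: vfield_eqP => f p; evaluate; ring.
Qed.

Lemma hyp_dev_bianchi X Y Z : T X Y Z + T Y Z X + T Z X Y = 0.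
Proof.
rewrite -(bianchi1 hnabla X Y Z) /T (Defs.metric_sym rg Y X) (Defs.metric_sym rg Z X).
by rewrite (Defs.metric_sym rg Z Y); apply: vfield_eqP => f p; evaluate; ring.
Qed.

Lemma hyp_dev_metric X Y Z W : g (T X Y Z) W = - g Z (T X Y W).
Proof.
have := curvature_metric rg hnabla X Y Z W; rewrite /T.
move: (K X Y Z) (K X Y W) => A B gAB; rewrite !(metricE rg) gAB (Defs.metric_sym rg Z X).
rewrite (Defs.metric_sym rg Z Y); apply: Cinf_eqP => p; evaluate; ring.
Qed.

Lemma hyp_dev_pair X Y Z W : g (T X Y Z) W = g (T Z W X) Y.
Proof.
have := curvature_pair rg hnabla X Y Z W; rewrite /T.
move: (K X Y Z) (K Z W X) => A B gAB; rewrite !(metricE rg) gAB (Defs.metric_sym rg Z X).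
rewrite (Defs.metric_sym rg Z Y) (Defs.metric_sym rg W X) (Defs.metric_sym rg W Y).
apply: Cinf_eqP => p; evaluate; ring.
Qed.

Lemma hyp_dev_linear1 Y Z : linear (fun X => T X Y Z).
Proof.
move=> f X W; rewrite /T (curvature_linear1 hnabla) !(metricE rg).
by apply: vfield_eqP => h p; evaluate; ring.
Qed.

Lemma hyp_dev_linear2 X Z : linear (fun Y => T X Y Z).
Proof.
move=> f Y W; rewrite /T (curvature_linear2 hnabla) !(metricE rg).
by apply: vfield_eqP => h p; evaluate; ring.
Qed.

Lemma hyp_dev_linear3 X Y : linear (T X Y).
Proof.
move=> f Z W; rewrite /T (curvature_linear3 hnabla) !(metricE rg).
by apply: vfield_eqP => h p; evaluate; ring.
Qed.

Lemma eta_hyp_dev X Y Z : eta (T X Y Z) = 0.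
Proof. by rewrite -g_xi hyp_dev_metric hyp_dev_xi3 -(scale0r 0) (metricZr rg) mul0r oppr0. Qed.

Lemma hyp_dev_xi2 X Y : T X xi Y = 0.
Proof.
apply: (metric_nondegenerate rg) => W.
by rewrite hyp_dev_pair g_xi eta_hyp_dev -(scale0r 0) (metricZl rg) mul0r.
Qed.

(** Pair symmetry turns commutation with [phi] into invariance in the first two slots; the term in
    [eta] from compatibility dies by [eta_hyp_dev]. *)
Lemma hyp_dev_phi2 X Y Z : T (phi X) (phi Y) Z = T X Y Z.
Proof.
apply: (metric_nondegenerate rg) => W.
rewrite hyp_dev_pair hyp_dev_phi (ks_compatible ks) eta_hyp_dev mul0r subr0.
by rewrite hyp_dev_pair.
Qed.

(** The added term is built from the metric alone, hence parallel. *)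
Lemma cov_deriv_hyp_dev W X Y Z :
  cov_deriv nabla T W X Y Z = cov_deriv nabla K W X Y Z.
Proof.
rewrite /cov_deriv /T; move: (curvature nabla) => K'.
rewrite !(nablaE hnabla) !(nabla_metric hnabla).
by apply: vfield_eqP => f p; evaluate; ring.
Qed.

(** In the two other terms of the second Bianchi identity [xi] fills a slot of [hyp_dev], so only
    its derivative survives; by [nabla_xi] that derivative is X, respectively Y, modulo [xi], and
    each term equals T(X, Y) Z. *)
Lemma cov_deriv_hyp_dev_xi X Y Z :
  cov_deriv nabla T xi X Y Z = - (T X Y Z + T X Y Z).
Proof.
have := bianchi2 hnabla xi X Y Z; rewrite -!cov_deriv_hyp_dev.
have T0 A B C : C = 0 -> T A B C = 0.
  by move=> ->; have := linear_ZE (hyp_dev_linear3 A B) 0 0; rewrite !scale0r.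
have E1 : cov_deriv nabla T X Y xi Z = T X Y Z.
  rewrite /cov_deriv !hyp_dev_xi2 (nabla0r hnabla) nabla_xi addrC [RHS]hyp_dev_skew.
  have := hyp_dev_linear2 Y Z (- eta X) xi X; rewrite hyp_dev_xi2 scaler0 add0r.
  by rewrite scaleNr [- _ + X]addrC => ->; rewrite !subr0 oppr0 !add0r.
have E2 : cov_deriv nabla T Y xi X Z = T X Y Z.
  have xi1 A B : T xi A B = 0 by rewrite hyp_dev_skew hyp_dev_xi2 oppr0.
  rewrite /cov_deriv !xi1 (nabla0r hnabla) nabla_xi [RHS]hyp_dev_skew.
  have := hyp_dev_linear1 X Z (- eta Y) xi Y; rewrite xi1 scaler0 add0r.
  by rewrite scaleNr [- _ + Y]addrC => ->; rewrite !subr0 add0r.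
by rewrite E1 E2 -addrA => /eqP; rewrite addr_eq0 => /eqP.
Qed.

End Kenmotsu.

(** * Traces of [hyp_dev] and the soliton equation *)

Section Soliton.
Context (R : realType) (m : nat) (M : manifold R m).
Local Notation X_M := (vfield M).
Context (phi : X_M -> X_M) (xi : X_M) (eta : X_M -> Cinf M) (g : X_M -> X_M -> Cinf M).
Context (nabla : X_M -> X_M -> X_M).
Implicit Types (f : Cinf M) (X Y Z W : X_M).
Hypothesis ks : kenmotsu_structure phi xi eta g nabla.
Let rg := ks_metric ks.
Let hnabla := ks_nabla ks.
Local Notation K := (curvature nabla).
Local Notation T := (hyp_dev g nabla).

Let gl Y f X Z : g (f *: X + Z) Y = f * g X Y + g Z Y.
Proof. exact: (Defs.metric_linear rg). Qed.

Let phil : linear phi := ks_phi_linear ks.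

Definition transverse X Y : Cinf M := g X Y - eta X * eta Y.
Local Notation h := transverse.

Definition dev_ricci Y W p : R := trace (fun Z => T Z Y W) p.

Definition dev_star X Y p : R := trace (fun Z => T X (phi Y) (phi Z)) p.

Let lin_star X Y : linear (fun Z => T X (phi Y) (phi Z)).
Proof. by move=> f Z W; rewrite phil (hyp_dev_linear3 ks). Qed.

Lemma dev_ricciE Y W p : dev_ricci Y W p = ricci nabla Y W p + (m%:R - 1) * g Y W p.
Proof.
have l1 := curvature_linear1 hnabla Y W.
have l2 : linear (fun Z => g Z W *: Y).
  by move=> f X Z; rewrite gl scalerDl scalerA.
have l3 : linear (fun Z : X_M => Z) by [].
rewrite /dev_ricci /T (trace_add p l1 (linear_add (linear_scale _ l3) (linear_opp l2))).
rewrite (trace_add p (linear_scale _ l3) (linear_opp l2)) trace_scale // trace_opp //.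
by rewrite trace_id (trace_rank1 Y p (gl W)) /ricci; ring.
Qed.


(** The correction consists of two rank-one endomorphisms, and each contributes one [h]. *)
Lemma dev_starE X Y p : dev_star X Y p =
  trace (fun Z => K X (phi Y) (phi Z)) p + 2 * h X Y p.
Proof.
have l1 : linear (fun Z => K X (phi Y) (phi Z)).
  by move=> f Z W; rewrite phil (curvature_linear3 hnabla).
have g1 f A B C : g C (phi (f *: A + B)) = f * g C (phi A) + g C (phi B).
  by rewrite phil (metricDr rg) (metricZr rg).
have l2 : linear (fun Z => g (phi Y) (phi Z) *: X).
  by move=> f A B; rewrite g1 scalerDl scalerA.
have l3 : linear (fun Z => g X (phi Z) *: phi Y).
  by move=> f A B; rewrite g1 scalerDl scalerA.
rewrite /dev_star /T (trace_add p l1 (linear_add l2 (linear_opp l3))).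
rewrite (trace_add p l2 (linear_opp l3)) trace_opp //.
rewrite (trace_rank1 X p (fun f A B => g1 f A B (phi Y))).
rewrite (trace_rank1 (phi Y) p (fun f A B => g1 f A B X)).
have -> : g X (phi (phi Y)) = - g (phi X) (phi Y) by rewrite (phi_skew ks) opprK.
by rewrite !(ks_compatible ks) (Defs.metric_sym rg Y) /h; evaluate; ring.
Qed.

(** By the first Bianchi identity and invariance under [phi], T(X, phi Y) phi Z = T(Z, Y) X - phi
    T(phi Z, X) Y. Under the trace the inner [phi] moves to the front by cyclicity, and - phi^2 is
    the identity on the values of [T]. *)
Lemma dev_starP X Y p : dev_star X Y p = dev_ricci X Y p + dev_ricci Y X p.
Proof.
have l1 := hyp_dev_linear1 ks Y X; have l2 := hyp_dev_linear1 ks X Y.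
have l3 : linear (fun Z => phi (T Z X Y)) by move=> f A B; rewrite l2 phil.
have l4 : linear (fun Z => phi (T (phi Z) X Y)) by move=> f A B; rewrite phil l2 phil.
have E : (fun Z => T X (phi Y) (phi Z)) = (fun Z => T Z Y X + - phi (T (phi Z) X Y)).
  apply/funext => Z; rewrite -(hyp_dev_phi ks).
  have := hyp_dev_bianchi ks X (phi Y) (phi Z); rewrite (hyp_dev_phi2 ks).
  by rewrite (hyp_dev_skew ks Y Z) => H; apply/eqP; rewrite -subr_eq0 opprD opprK addrA H.
rewrite /dev_star E (trace_add p l1 (linear_opp l4)) trace_opp //.
rewrite (trace_comp p l3 phil).
have -> : (fun Z => phi (phi (T Z X Y))) = (fun Z => - T Z X Y).
  by apply/funext => Z; rewrite (ks_phi2 ks) (eta_hyp_dev ks) scale0r addr0.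
by rewrite trace_opp // opprK addrC.
Qed.

(** By the first Bianchi identity the two sides differ by the trace of T(Y, X), which is skew for
    the metric. *)
Lemma dev_ricci_sym X Y p : dev_ricci X Y p = dev_ricci Y X p.
Proof.
have l1 := hyp_dev_linear1 ks Y X; have l2 := hyp_dev_linear3 ks Y X.
have E : (fun Z => T Z X Y) = (fun Z => T Z Y X + T Y X Z).
  apply/funext => Z; have := hyp_dev_bianchi ks Z Y X.
  by rewrite (hyp_dev_skew ks X Z) => /eqP; rewrite subr_eq0 => /eqP.
rewrite /dev_ricci E (trace_add p l1 l2) (trace_skew p rg l2) ?addr0 // => A B.
exact: (hyp_dev_metric ks Y X A B).
Qed.

(** Along [xi] the tensor [phi] is parallel because phi xi = 0, so only nabla_xi T = - 2 T
    contributes. The function [s] supplies the smoothness that a pointwise trace does not carry in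
    its type. *)
Lemma dev_star_deriv X Y (s : Cinf M) p : (forall q, dev_star X Y q = s q) ->
  xi s p = - 2 * dev_star X Y p + dev_star (nabla xi X) Y p + dev_star X (nabla xi Y) p.
Proof.
move=> sE; rewrite -(trace_derivative p (nablaDr hnabla xi)
  (fun f Z => nablaZr hnabla f xi Z) (lin_star X Y) sE).
have nphi A : nabla xi (phi A) = phi (nabla xi A).
  rewrite (ks_nabla_phi ks) (phi_xi ks) scaler0 subr0.
  have -> : g 0 A = 0 by rewrite -(scale0r 0) (metricZl rg) mul0r.
  by rewrite scale0r addr0.
have E : (fun Z => nabla xi (T X (phi Y) (phi Z)) - T X (phi Y) (phi (nabla xi Z))) =
    (fun Z => - (T X (phi Y) (phi Z) + T X (phi Y) (phi Z)) +
       (T (nabla xi X) (phi Y) (phi Z) + T X (phi (nabla xi Y)) (phi Z))).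
  apply/funext => Z; rewrite -(cov_deriv_hyp_dev_xi ks) /cov_deriv !nphi.
  move: (nabla xi (T X (phi Y) (phi Z))) (T X (phi Y) (phi (nabla xi Z)))
    (T (nabla xi X) (phi Y) (phi Z)) (T X (phi (nabla xi Y)) (phi Z)) => a d b c.
  by apply: vfield_eqP => f q; evaluate; ring.
have l1 := lin_star X Y; have l2 := lin_star (nabla xi X) Y.
have l3 := lin_star X (nabla xi Y).
rewrite E (trace_add p (linear_opp (linear_add l1 l1)) (linear_add l2 l3)).
rewrite (trace_opp p (linear_add l1 l1)) (trace_add p l1 l1) (trace_add p l2 l3).
rewrite -!/(dev_star _ _ _); move: (dev_star X Y p) (dev_star (nabla xi X) Y p)
  (dev_star X (nabla xi Y) p) => a b c; ring.
Qed.

(** If [h] vanished at [p], all tangent vectors there would be multiples of [xi], which contradicts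
    the existence of several independent ones. *)
Lemma transverse_neq0 (p : M) : (2 < m)%N -> exists X, h X X p != 0.
Proof.
move=> m2; have [//|nh] := pselect (exists X, h X X p != 0).
have h0 X f : X f p = eta X p * xi f p.
  have : tangent_eq p (X - eta X *: xi) 0.
    apply: (metric_eq0_at rg).
    have [//|] := eqVneq (h X X p) 0; last by move=> hX; case: nh; exists X.
    rewrite !(metricE rg) !(g_xi ks) !(g_xil ks) (ks_eta_xi ks) mulr1 /h.
    by evaluate => hX; rewrite -[RHS]hX; ring.
  by move=> /(_ f); evaluate => /eqP; rewrite subr_eq0 => /eqP.
have [om [E [th [om0 cf]]]] := coframe_at p.
have fr := coframe_frame cf om0.
pose i0 : 'I_m := Ordinal (ltn_trans (isT : (0 < 2)%N) m2).
have e0 i : eta (E i) p = 0.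
  have [j ij] : exists j, j != i.
    have [->|ni0] := eqVneq i i0; last by exists i0; rewrite eq_sym.
    by exists (Ordinal (ltn_trans (isT : (1 < 2)%N) m2)).
  (* The relation used is eta(E_i) E_j - eta(E_j) E_i = 0 at [p], valid because both vectors are
     multiples of [xi]. *)
  have := fr (fun k => if k == j then eta (E i) p
    else if k == i then - eta (E j) p else 0) _ j.
  rewrite eqxx; apply => f.
  have ji : i != j by rewrite eq_sym.
  rewrite (bigD1 j) //= eqxx (bigD1 i) //= (negbTE ji) eqxx.
  rewrite big1 ?addr0 => [|k /andP[/negbTE -> /negbTE ->]]; last by rewrite mul0r.
  by rewrite (h0 (E j)) (h0 (E i)); ring.
have := fr (fun k => (k == i0)%:R) _ i0; rewrite eqxx => H.
have /eqP : (1 : R) = 0; last by rewrite oner_eq0.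
apply: H => f; rewrite (bigD1 i0) //= h0 e0 mul0r mulr0 add0r big1 // => k /negbTE ->.
by rewrite mul0r.
Qed.

(** By [nabla_xi] the Lie derivative of the metric along [xi] is 2 h; the other two terms come from
    differentiating [a]. *)
Lemma lie_derivative_collinear (a : Cinf M) X Y p :
  lie_derivative_metric (a *: xi) g X Y p =
  X a p * eta Y p + Y a p * eta X p + 2 * (a p * h X Y p).
Proof.
rewrite /lie_derivative_metric !(bracketE hnabla) (nabla_metric hnabla (a *: xi)).
rewrite !(nablaZr hnabla) !(nabla_xi ks).
move: (nabla _ X) (nabla _ Y) => A B.
rewrite !(metricE rg) !(g_xi ks) !(g_xil ks) /h; evaluate; ring.
Qed.

Lemma transverse_xi X p : h X xi p = 0.
Proof. by rewrite /h (g_xi ks) (ks_eta_xi ks) mulr1 subrr. Qed.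

Lemma dev_star_xi X p : dev_star X xi p = 0.
Proof.
rewrite /dev_star (phi_xi ks).
have -> : (fun Z => T X 0 (phi Z)) = (fun=> 0); last exact: trace_zero.
apply/funext => Z.
by have := linear_ZE (hyp_dev_linear2 ks X (phi Z)) 0 0; rewrite !scale0r.
Qed.

(** Both [g] and [eta] are parallel along [xi], the latter because nabla_xi xi = 0. *)
Lemma xi_transverse X Y : xi (h X Y) = h (nabla xi X) Y + h X (nabla xi Y).
Proof.
have xe A : xi (eta A) = eta (nabla xi A).
  by rewrite (vfield_eta ks) (g_xil ks) (ks_eta_xi ks) mul1r subrr addr0.
rewrite /h vfieldB vfieldM !xe (nabla_metric hnabla).
by apply: Cinf_eqP => p; evaluate; ring.
Qed.

Section Collinear.
Context (a : Cinf M) (lam : R).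
Hypothesis sol : forall X Y p, lie_derivative_metric (a *: xi) g X Y p
  + 2 * (2^-1 * trace (fun Z => K X (phi Y) (phi Z)) p) + 2 * lam * g X Y p = 0.

Let sol' X Y p : X a p * eta Y p + Y a p * eta X p + 2 * (a p * h X Y p)
  + (dev_star X Y p - 2 * h X Y p) + 2 * lam * g X Y p = 0.
Proof.
rewrite -(sol X Y p) lie_derivative_collinear dev_starE.
by move: (trace _ p) => t; field.
Qed.

Let eta_xi_at p : eta xi p = 1.
Proof. by rewrite (ks_eta_xi ks). Qed.

Lemma soliton_differential X p : X a p = - lam * eta X p.
Proof.
(* With [xi] in the second slot [h] and [dev_star] vanish; the instance at (xi, xi) gives xi a = -
   lam, which then resolves the one at (X, xi). *)
have := sol' X xi p; have := sol' xi xi p.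
rewrite !transverse_xi !dev_star_xi !(g_xi ks) !eta_xi_at => E1 E2.
have E3 : xi a p = - lam by lra.
by rewrite E3 in E2; lra.
Qed.

(** The two terms in da add up to - 2 lam eta eta, which turns 2 lam g into 2 lam h. *)
Lemma soliton_dev_star X Y p :
  dev_star X Y p = 2 * (1 - a p - lam) * h X Y p.
Proof.
have := sol' X Y p; rewrite !soliton_differential /h; evaluate => E; lra.
Qed.

(** For c = 2 (1 - a - lam), differentiating dev_star = c h gives xi c = - 2 c where [h] is
    non-zero, whereas xi a = - lam gives xi c = 2 lam. *)
Lemma soliton_potential : (2 < m)%N -> forall p, a p = 1 - lam / 2.
Proof.
move=> m2 p; have [X hX] := transverse_neq0 p m2.
pose c := Cinf_cst M 2 * (1 - a - Cinf_cst M lam).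
have cE q : c q = 2 * (1 - a q - lam) by [].
have dE A B q : dev_star A B q = (c * h A B) q by rewrite CinfME cE soliton_dev_star.
have := dev_star_deriv p (dE X X).
rewrite !dE vfieldM xi_transverse; evaluate.
have -> : xi c p = 2 * lam.
  rewrite /c vfieldZ !vfieldB vfield1 vfield_cst; evaluate.
  by rewrite soliton_differential eta_xi_at Cinf_cstE -[(0 : Cinf M) p]/(0 : R); ring.
rewrite cE => E; apply: (mulfI hX); lra.
Qed.

Lemma soliton_constant : (2 < m)%N -> forall p, lam = 0 /\ a p = 1.
Proof.
move=> m2 p; have aE := soliton_potential m2.
have ac : a = Cinf_cst M (1 - lam / 2) by apply: Cinf_eqP.
have := soliton_differential xi p; rewrite ac vfield_cst eta_xi_at Cinf_cstE.
by rewrite -[(0 : Cinf M) p]/(0 : R) => E; split; lra.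
Qed.

Lemma soliton_ricci : (2 < m)%N -> forall X Y p,
  ricci nabla X Y p = (1 - m%:R) * g X Y p.
Proof.
move=> m2 X Y p; have [l0 a1] := soliton_constant m2 p.
have := soliton_dev_star X Y p; rewrite dev_starP (dev_ricci_sym Y X) l0 a1 dev_ricciE => E.
lra.
Qed.

End Collinear.
End Soliton.

Theorem theorem3p4 (R : realType) (n : nat) (hn : (1 <= n)%N)
    (M : manifold R (2 * n).+1) (S : almost_contact_metric M)
    (nabla : vfield M -> vfield M -> vfield M)
    (hnabla : levi_civita (acm_g S) nabla)
    (hK : kenmotsu S nabla)
    (V : vfield M) (lam : R)
    (hV0 : V <> 0)
    (hsol : star_ricci_soliton S nabla V lam)
    (a : Cinf M) (hcol : V = a *: acm_xi S) :
  einstein (acm_g S) nabla /\ V = acm_xi S.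
Proof.
have m2 : (2 < (2 * n).+1)%N by rewrite ltnS -[X in (X <= _)%N]muln1 leq_mul2l.
have ks : kenmotsu_structure (acm_phi S) (acm_xi S) (acm_eta S) (acm_g S) nabla.
  split=> //; [exact: acm_riemannian|exact: linearP|exact: linearP|exact: acm_phi2
    |exact: acm_eta_xi|exact: acm_compatible|].
  by move=> X Y; rewrite -hK addrCA subrr addr0.
move: hsol; rewrite hcol => sol; split.
  (* The Einstein constant is - 2 n. *)
  by exists (1 - (2 * n).+1%:R) => X Y p; exact: (soliton_ricci ks sol m2).
apply: vfield_eqP => f p.
by rewrite vfieldZE (soliton_constant ks sol m2 p).2 mul1r.
Qed.
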